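(* Let $c = 1 - \frac{1+\log_2 2}{\log 2}$. For almost all $\alpha > 0$ (with respect to Lebesgue measure), $$\delta_{\min}^{(\alpha)}(N) \leq \frac{(\log N)^{2c}}{N \log N} \qquad \text{only for finitely many } N,$$ as well as $$\delta_{\min}^{(\alpha)}(N) \geq \frac{(\log N)^{2c}}{N} \qquad \text{for infinitely many } N.$$
   Context: For irrational $\alpha > 0$, let $0 < \lambda_1 < \lambda_2 < \cdots$ be the elements of the set $\{\alpha m^2 + n^2 : m,n \geq 1 \text{ integers}\}$ listed in increasing order (these are distinct since $\alpha$ is irrational). Define $\delta_{\min}^{(\alpha)}(N) = \min\{\lambda_{k+1} - \lambda_k : 1 \leq k \leq N\}$. Here $\log_2 2 = \log\log 2$ in the usual sense ($c \approx 0.086$), and $\log N$ means $\max\{1,\log N\}$. *)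

(* Defs.v *)
From mathcomp Require Import all_boot all_order all_algebra.
From mathcomp Require Import all_classical all_reals all_analysis.
Set Implicit Arguments. Unset Strict Implicit. Unset Printing Implicit Defensive.
Import Order.TTheory GRing.Theory Num.Theory.
Local Open Scope classical_set_scope.
Local Open Scope ring_scope.

(* log N means max{1, log N} (natural logarithm). *)
Definition logm {R : realType} (x : R) : R := Num.max 1 (ln x).

Definition c_const {R : realType} : R := 1 - (1 + ln (ln 2)) / ln 2.

Definition specset {R : realType} (alpha : R) : set R :=
  [set x | exists m n : nat, (1 <= m)%N /\ (1 <= n)%N /\
                             x = alpha * (m%:R) ^+ 2 + (n%:R) ^+ 2].

(* lam is the increasing enumeration of specset alpha, shifted by one:
   lam k = lambda_{k+1} in the paper's notation. *)
Definition sorted_enum {R : realType} (alpha : R) (lam : nat -> R) : Prop :=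
  (forall i j : nat, (i < j)%N -> lam i < lam j) /\ range lam = specset alpha.

(* delta_min(N) = min_{1 <= k <= N} (lambda_{k+1} - lambda_k)
               = min_{0 <= i < N} (lam (i+1) - lam i); used for N >= 1
   (the seed lam 1 - lam 0 is the i = 0 term, so it does not change the min). *)
Definition delta_min {R : realType} (lam : nat -> R) (N : nat) : R :=
  \big[Num.min/(lam 1%N - lam 0%N)]_(i < N) (lam i.+1 - lam i).

(* Main.v *)
(* If a gap below lambda_N is at most eta, then |alpha A - B| <= eta for some A, B
   in the multiplication table T_y = {a b : a, b <= y} with y of order sqrt N. As
   alpha varies in a compact subset of (0, oo), this happens on a set of measure
   O(eta Z^2), where Z is the sum of n^(-1/2) over n in T_y. Along N = 4^k these
   measures are summable for the eta of the first claim and tend to 0 for that of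
   the second, since Z << y (log y)^(-c) (log log y)^(-3/4).

   Weighting n = a b by log a log b and removing a prime power from each factor
   bounds Z by y (log y)^(-2) times the sum of G(m) / m, where
   G(m) <= tau(r) (1 + log s) whenever m = r s. The square part of m is harmless.
   For squarefree m = p_1 ... p_k take s = p_1 ... p_j: G(m) is much smaller than
   min(2^k, log y) as soon as some p_j is much smaller than exp(exp(j log 2)).
   Hence, up to Rankin-type bounds, only the m whose prime factors stay above this
   barrier matter. A ballot-type count, in which the volume of the points above a
   linear barrier is compared with an Abel polynomial, shows that these are rarer
   by a factor log log y, up to powers of log log log y. *)
Require Import Defs.
From mathcomp Require Import all_boot all_order all_algebra.
From mathcomp Require Import all_classical all_reals all_analysis.
From mathcomp Require Import zify ring lra.
Set Implicit Arguments. Unset Strict Implicit. Unset Printing Implicit Defensive.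
Import Order.TTheory GRing.Theory Num.Theory.
Local Open Scope classical_set_scope.
Local Open Scope ring_scope.

(** * Chebyshev and Mertens estimates *)

Section VonMangoldt.
Context {R : realType}.

(** The obstacle is the first claim. With [X] of order log log y, the Poisson law for the number of
    prime factors alone saves only [X^(-1/2)] in Z, hence [1 / X] in its square; at the scale [4^k]
    the measures are then of order [1 / (k log k)], a series that just diverges. The rest must come
    from the barrier. The ballot factor, about [u / X] for a barrier relaxed by [u], suffices on its
    own, so factorials are estimated without Stirling's square root.

    Here [u] has to be of order [log X], so that lists crossing the barrier lose a power of [X]. A
    plain Abel polynomial would then cost [exp u], again a power of [X]; raising its degree by
    [q = (u + 2)^2] reduces the cost to a power of [u]. *)

Definition mangoldt (d : nat) : R := if primes d is [:: p] then ln p%:R else 0.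

Lemma mangoldt_ge0 d : 0 <= mangoldt d.
Proof.
rewrite /mangoldt; case E: (primes d) => [|p [|q s]] //.
have : p \in primes d by rewrite E inE.
by rewrite mem_primes => /and3P[/prime_gt0 p0 _ _]; rewrite ln_ge0 // ler1n.
Qed.

Lemma mangoldt_pfactor p k : prime p -> mangoldt (p ^ k.+1) = ln p%:R.
Proof. by move=> pp; rewrite /mangoldt primesX // primes_prime. Qed.

Lemma mangoldt_prime p : prime p -> mangoldt p = ln p%:R.
Proof. by move=> pp; rewrite -[p in LHS]expn1 mangoldt_pfactor. Qed.

Lemma mangoldt_neq0 d : mangoldt d != 0 -> exists p k, prime p /\ d = (p ^ k.+1)%N.
Proof.
rewrite /mangoldt; case E: (primes d) => [|p [|q s]]; rewrite ?eqxx // => _.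
have : p \in primes d by rewrite E inE.
rewrite mem_primes => /and3P[pp d0 pd].
exists p, (logn p d).-1; split => //.
rewrite prednK; last by rewrite logn_gt0 mem_primes pp d0.
by rewrite [LHS]prod_prime_decomp // prime_decompE E /= big_seq1.
Qed.

(** Passing from [m] to [p * m] adds exactly one prime power divisor, the next power of [p]; this
    drives the induction in [sum_mangoldt], which strips one prime at a time. *)
Lemma mangoldt_dvd_step p m d : prime p -> (0 < m)%N ->
  (d %| p * m)%:R * mangoldt d =
  (d %| m)%:R * mangoldt d + (d == p ^ (logn p m).+1)%N%:R * ln p%:R.
Proof.
move=> pp m0; have [L0|Ln0] := eqVneq (mangoldt d) 0.
  rewrite L0 !mulr0 add0r; case: eqP => [E|]; last by rewrite mul0r.
  by rewrite E mangoldt_pfactor // in L0; rewrite L0 mulr0.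
have [q [k [qp E]]] := mangoldt_neq0 Ln0; rewrite E mangoldt_pfactor //.
have pm0 : (0 < p * m)%N by rewrite muln_gt0 prime_gt0.
have [qE|qNp] := eqVneq q p.
  have lE : logn p (p * m) = (logn p m).+1.
    by rewrite lognM ?(prime_gt0 pp) // (logn_prime p pp) eqxx.
  rewrite qE !pfactor_dvdn // lE.
  rewrite eqn_exp2l ?prime_gt1 // eqSS ltnS.
  by case: (ltngtP k (logn p m)) => _; rewrite ?mul1r ?mul0r ?addr0 ?add0r.
rewrite Gauss_dvdr; last first.
  by rewrite coprime_pexpl // prime_coprime // dvdn_prime2.
rewrite (_ : (_ == _) = false) ?mul0r ?addr0 //.
apply/negbTE/eqP => /(congr1 primes); rewrite !primesX // !primes_prime // => -[].
by move/eqP; rewrite (negbTE qNp).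
Qed.

Lemma sum_mangoldt n N : (0 < n < N)%N ->
  \sum_(1 <= d < N) (d %| n)%:R * mangoldt d = ln n%:R.
Proof.
have [k] := ubnP n; elim: k n => // k IH n nk /andP[n0 nN].
have [n1|n1] := leqP n 1.
  have -> : n = 1%N by lia.
  rewrite ln1 big1_seq // => d /= _; rewrite dvdn1; case: eqP => [->|]; last by rewrite mul0r.
  by rewrite /mangoldt /= mulr0.
have [p pp /dvdnP[m E]] := pdivP n1.
have p1 := prime_gt1 pp; have m0 : (0 < m)%N by case: m E => [|//]; rewrite mul0n => E; move: n0; rewrite E.
rewrite E mulnC in nN nk n0 *.
have mN : (0 < m < N)%N by apply/andP; split => //; nia.
have mk : (m < k)%N by nia.
under eq_bigr do rewrite mangoldt_dvd_step //.
rewrite big_split /= (IH m) //.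
have D0N : ((p ^ (logn p m).+1)%N <= p * m)%N by rewrite expnS leq_pmul2l ?prime_gt0 // dvdn_leq // pfactor_dvdnn.
rewrite (bigD1_seq (p ^ (logn p m).+1)%N) ?iota_uniq //=; last first.
  by rewrite mem_index_iota expn_gt0 prime_gt0 //=; lia.
rewrite eqxx mul1r big1 ?addr0; last by move=> i /negbTE ->; rewrite mul0r.
by rewrite natrM lnM ?posrE ?ltr0n ?(prime_gt0 pp) // addrC.
Qed.

Lemma ln_fact N : ln (N`!)%:R = \sum_(1 <= d < N.+1) mangoldt d * (N %/ d)%:R :> R.
Proof.
transitivity (\sum_(1 <= n < N.+1) (ln n%:R : R)).
  elim: N => [|N IH]; first by rewrite big_geq // fact0 ln1.
  by rewrite big_nat_recr //= -IH factS natrM lnM ?posrE ?ltr0n ?fact_gt0 // addrC.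
transitivity (\sum_(1 <= n < N.+1) \sum_(1 <= d < N.+1) (d %| n)%:R * mangoldt d).
  by apply: eq_big_nat => n /andP[n1 nN]; rewrite sum_mangoldt // n1.
rewrite exchange_big /=; apply: eq_bigr => d _.
by rewrite -mulr_suml mulrC divn_count_dvd natr_sum.
Qed.

Definition psi (N : nat) : R := \sum_(1 <= d < N.+1) mangoldt d.

Lemma psiS N : psi N.+1 = psi N + mangoldt N.+1.
Proof. by rewrite /psi big_nat_recr. Qed.

Lemma ler_ln_nat n : ln n%:R <= n%:R :> R.
Proof.
case: n => [|n]; first by rewrite ln0.
by apply/ltW/ln_sublinear; rewrite ltr0n.
Qed.

Lemma mangoldt_le d : mangoldt d <= d%:R.
Proof.
have [->|/mangoldt_neq0[p [k [pp ->]]]] := eqVneq (mangoldt d) 0; first exact: ler0n.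
rewrite mangoldt_pfactor //; apply: le_trans (ler_ln_nat p) _.
by rewrite ler_nat expnS leq_pmulr // expn_gt0 prime_gt0.
Qed.

(** Chebyshev's argument: in the logarithm of the central binomial coefficient every [d] with
    [n < d <= 2 * n] has coefficient 1 and no coefficient is negative, while the binomial is at most
    [2^(2 n)]. *)
Lemma psi_double n : psi (2 * n) <= psi n + 2 * n%:R.
Proof.
have E : ln ('C(2 * n, n))%:R =
   \sum_(1 <= d < (2 * n).+1) mangoldt d * ((2 * n) %/ d - 2 * (n %/ d))%:R :> R.
  have : ln ((2 * n)`!)%:R = ln ('C(2 * n, n))%:R + 2 * ln (n`!)%:R :> R.
    have n2 : (n <= 2 * n)%N by lia.
    rewrite -(bin_fact n2) (_ : (2 * n - n)%N = n); last lia.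
    have p0 : (0 < 'C(2 * n, n))%N by rewrite bin_gt0.
    by rewrite !natrM !lnM ?posrE ?mulr_gt0 ?ltr0n ?fact_gt0 //; lra.
  move=> h; have -> : ln 'C(2 * n, n)%:R = ln (2 * n)`!%:R - 2 * ln n`!%:R :> R by rewrite h addrK.
  rewrite !ln_fact.
  rewrite (_ : \sum_(1 <= d < n.+1) _ = \sum_(1 <= d < (2 * n).+1) mangoldt d * (n %/ d)%:R); last first.
    rewrite [RHS](big_cat_nat (n := n.+1)) //=; last lia.
    rewrite [X in _ + X]big1_seq ?addr0 // => d; rewrite mem_index_iota => /andP[_ /andP[dn _]].
    by rewrite divn_small ?mulr0.
  rewrite mulr_sumr -sumrB; apply: eq_big_nat => d /andP[d1 _].
  have le2 : (2 * (n %/ d) <= (2 * n) %/ d)%N.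
    by rewrite leq_divRL // -mulnA leq_mul2l leq_divM.
  by rewrite natrB // natrM mulrBr; ring.
have up : ln ('C(2 * n, n))%:R <= 2 * n%:R :> R.
  have h : ('C(2 * n, n) <= 2 ^ (2 * n))%N.
    rewrite -[2%N]/(1 + 1)%N expnDn.
    under eq_bigr do rewrite !exp1n !muln1.
    have n2 : (n < (2 * n).+1)%N by lia.
    by rewrite (bigD1 (Ordinal n2)) //= leq_addr.
  apply: le_trans (_ : ln ((2 ^ (2 * n))%N%:R) <= _).
    by rewrite ler_ln ?posrE ?ltr0n ?bin_gt0 ?expn_gt0 ?ler_nat //; lia.
  rewrite natrX lnXn ?ltr0n // -[ln _ *+ _]mulr_natr natrM.
  have : ln 2%:R <= 1 :> R by have := @le_ln1Dx R 1; rewrite -natr1; apply; lra.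
  by have : 0 <= n%:R :> R by []; nra.
rewrite -lerBlDl; apply: le_trans up; rewrite E /psi.
rewrite [X in X - _](big_cat_nat (n := n.+1)) //=; last lia.
rewrite [X in X - _]addrC addrK [leRHS](big_cat_nat (n := n.+1)) //=; last lia.
rewrite -[leLHS]add0r; apply: lerD.
  by apply: sumr_ge0 => d _; rewrite mulr_ge0 ?mangoldt_ge0.
apply: ler_sum_nat => d /andP[dn d2].
rewrite (divn_small dn).
rewrite ler_peMr ?mangoldt_ge0 // ler1n muln0 subn0.
by rewrite divn_gt0 //; lia.
Qed.

Lemma psi_le N : psi N <= 4 * N%:R.
Proof.
have [k] := ubnP N; elim: k N => // k IH N Nk.
have [->|N0] := posnP N; first by rewrite /psi big_geq // mulr0.
have [n [E|E]] : exists n, N = (2 * n)%N \/ N = (2 * n).+1.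
  by exists N./2; have := odd_double_half N; case: (odd N); lia.
- rewrite E; apply: le_trans (psi_double n) _.
  have : psi n <= 4 * n%:R by apply: IH; lia.
  by rewrite natrM; have : 0 <= n%:R :> R by []; nra.
- rewrite E psiS; have := psi_double n.
  have : psi n <= 4 * n%:R by apply: IH; lia.
  have := mangoldt_le (2 * n).+1.
  by rewrite -natr1 natrM; have : 0 <= n%:R :> R by []; nra.
Qed.

Lemma sqrt_natS_gap (n : nat) : (0 < n)%N ->
  n%:R * (1 / Num.sqrt n%:R - 1 / Num.sqrt n.+1%:R) <= Num.sqrt n.+1%:R - Num.sqrt n%:R :> R.
Proof.
move=> n0; set a := Num.sqrt n%:R; set b := Num.sqrt n.+1%:R.
have a0 : 0 < a by rewrite sqrtr_gt0 ltr0n.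
have ab : a <= b by rewrite ler_sqrt ?ler_nat ?ltr0n.
have -> : n%:R = a * a by rewrite -expr2 sqr_sqrtr.
have b0 : 0 < b by lra.
have -> : a * a * (1 / a - 1 / b) = a / b * (b - a) by field; rewrite !gt_eqF.
by rewrite ler_piMl ?subr_ge0 // ler_pdivrMr // mul1r.
Qed.

Lemma sum_mangoldt_sqrt N :
  \sum_(1 <= d < N.+1) mangoldt d / Num.sqrt d%:R <= 8 * Num.sqrt N%:R.
Proof.
have [->|N0] := posnP N; first by rewrite big_geq // sqrtr0 mulr0.
have s0 : 0 < Num.sqrt N%:R :> R by rewrite sqrtr_gt0 ltr0n.
(* Abel summation by induction: the boundary term [psi N / sqrt N] is kept in the bound, and its
   correction is paid by the increment of [4 * sqrt N] through [sqrt_natS_gap]. *)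
apply: (@le_trans _ _ (psi N / Num.sqrt N%:R + 4 * Num.sqrt N%:R)); last first.
  suff : psi N / Num.sqrt N%:R <= 4 * Num.sqrt N%:R by lra.
  by rewrite ler_pdivrMr // -mulrA -expr2 sqr_sqrtr // psi_le.
case: N N0 {s0} => // N _; elim: N => [|N IH].
  by rewrite /psi !big_nat1 lerDl mulr_ge0.
rewrite big_nat_recr //= psiS.
have := @sqrt_natS_gap N.+1 isT; have := psi_le N.+1.
set a := Num.sqrt N.+1%:R; set b := Num.sqrt N.+2%:R in IH *.
have a0 : 0 < a by rewrite sqrtr_gt0 ltr0n.
have ab : a <= b by rewrite ler_sqrt ?ler_nat ?ltr0n.
have d0 : 0 <= 1 / a - 1 / b.
  by rewrite subr_ge0 !div1r lef_pV2 ?posrE //; lra.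
move=> h1 h2; have := ler_wpM2r d0 h1.
move: IH; rewrite -/a => IH.
have -> : (psi N.+1 + mangoldt N.+2) / b = psi N.+1 / a - psi N.+1 * (1 / a - 1 / b) + mangoldt N.+2 / b.
  by field; rewrite !gt_eqF //; lra.
by lra.
Qed.

Lemma ln_fact_le N : ln (N`!)%:R <= N%:R * ln N%:R :> R.
Proof.
elim: N => [|N IH]; first by rewrite mul0r ln1.
rewrite factS natrM lnM ?posrE ?ltr0n ?fact_gt0 //.
have : ln N%:R <= ln N.+1%:R :> R.
  have [->|N0] := posnP N; first by rewrite ln1 ln0.
  by rewrite ler_ln ?posrE ?ltr0n ?ler_nat.
have : 0 <= N%:R :> R by [].
by rewrite -(natr1 N) => h0 h1; nra.
Qed.

Lemma ln_natS_gap (N : nat) : (0 < N)%N -> ln N.+1%:R - ln N%:R <= N%:R^-1 :> R.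
Proof.
move=> N0; rewrite -ln_div ?posrE ?ltr0n // -natr1 mulrDl divff ?pnatr_eq0 -?lt0n // div1r.
by apply: le_ln1Dx; apply: lt_trans (_ : 0 < _); rewrite ?invr_gt0 ?ltr0n // ltrN10.
Qed.

Lemma ln_fact_ge N : N%:R * ln N%:R - N%:R <= ln (N`!)%:R :> R.
Proof.
elim: N => [|N IH]; first by rewrite mul0r subr0 ln1.
rewrite factS natrM lnM ?posrE ?ltr0n ?fact_gt0 //.
have [->|N0] := posnP N; first by rewrite fact0 !ln1 mulr0 sub0r addr0 lerN10.
have := ln_natS_gap N0; have h0 : 0 < N%:R :> R by rewrite ltr0n.
move=> /(ler_wpM2l (ltW h0)); rewrite mulfV ?gt_eqF // -(natr1 N) in IH *.
by move: IH; lra.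
Qed.

(** Mertens: replacing [N %/ d] by [N / d] in [ln_fact] costs at most [psi N], which is at most
    [4 * N]. *)
Lemma sum_mangoldt_div_le N : (0 < N)%N ->
  \sum_(1 <= d < N.+1) mangoldt d / d%:R <= ln N%:R + 4.
Proof.
move=> N0; have n0 : 0 < N%:R :> R by rewrite ltr0n.
rewrite -(ler_pM2l n0) mulrDr.
apply: le_trans (_ : ln (N`!)%:R + psi N <= _); last first.
  by rewrite lerD ?ln_fact_le // mulrC psi_le.
rewrite ln_fact /psi -big_split /= mulr_sumr; apply: ler_sum_nat => d /andP[d0 _].
have d1 : 0 < d%:R :> R by rewrite ltr0n.
have -> : N%:R * (mangoldt d / d%:R) = mangoldt d * (N%:R / d%:R) by ring.
have : N%:R / d%:R <= (N %/ d)%:R + 1 :> R.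
  by rewrite ler_pdivrMr // natr1 -natrM ler_nat ltnW // ltn_ceil.
by move=> /(ler_wpM2l (mangoldt_ge0 d)); lra.
Qed.

Lemma sum_mangoldt_div_ge N : (0 < N)%N ->
  ln N%:R - 1 <= \sum_(1 <= d < N.+1) mangoldt d / d%:R.
Proof.
move=> N0; have n0 : 0 < N%:R :> R by rewrite ltr0n.
rewrite -(ler_pM2l n0) mulrBr mulr1.
apply: le_trans (ln_fact_ge N) _.
rewrite ln_fact mulr_sumr; apply: ler_sum_nat => d /andP[d0 _].
have d1 : 0 < d%:R :> R by rewrite ltr0n.
have -> : N%:R * (mangoldt d / d%:R) = mangoldt d * (N%:R / d%:R) by ring.
apply: ler_wpM2l; first exact: mangoldt_ge0.
by rewrite ler_pdivlMr // -natrM ler_nat leq_divM.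
Qed.

Lemma sum_ln_prime_div_le N : (0 < N)%N ->
  \sum_(1 <= p < N.+1 | prime p) ln p%:R / p%:R <= ln N%:R + 4 :> R.
Proof.
move=> N0; apply: le_trans (sum_mangoldt_div_le N0).
rewrite big_mkcond /=; apply: ler_sum => p _; case: ifP => [pp|_].
  by rewrite mangoldt_prime.
by rewrite divr_ge0 ?mangoldt_ge0.
Qed.

Definition prsum (N : nat) : R := \sum_(1 <= p < N.+1 | prime p) p%:R^-1.

Lemma prsumS N : prsum N.+1 = prsum N + (prime N.+1)%:R / N.+1%:R.
Proof.
rewrite /prsum big_mkcond /= big_nat_recr //= -big_mkcond /=.
by case: (prime _); rewrite ?mul1r ?mul0r.
Qed.

Lemma prsum_ge0 N : 0 <= prsum N.
Proof. by apply: sumr_ge0 => p _; rewrite invr_ge0. Qed.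

Lemma le_prsum M N : (M <= N)%N -> prsum M <= prsum N.
Proof.
move=> /subnK <-; elim: (N - M)%N => // k IH.
by rewrite addSn prsumS (le_trans IH) // lerDl divr_ge0.
Qed.

(** The left side is an Abel summation increment in [t = ln N], with the partial sums replaced by
    [t + 4]; the right side is the increment of [ln t - 4 / t], an antiderivative of
    [(t + 4) / t^2]. *)
Let lnS_gap_div (N : nat) : (2 <= N)%N ->
  (ln N%:R + 4) * (1 / ln N%:R - 1 / ln N.+1%:R) <=
  (ln (ln N.+1%:R) - 4 / ln N.+1%:R) - (ln (ln N%:R) - 4 / ln N%:R) :> R.
Proof.
move=> N2; set a := ln N%:R; set b := ln N.+1%:R.
have a0 : 0 < a by rewrite ln_gt0 // ltr1n.
have ab : a <= b by rewrite ler_ln ?posrE ?ltr0n ?ler_nat //; lia.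
have b0 : 0 < b by lra.
suff : 1 - a / b <= ln b - ln a.
  have -> : (a + 4) * (1 / a - 1 / b) = (1 - a / b) + (4 / a - 4 / b) by field; rewrite !gt_eqF.
  by lra.
have -> : ln b - ln a = - ln (a / b) by rewrite ln_div ?posrE //; lra.
have : -1 < a / b - 1 by have := divr_gt0 a0 b0; lra.
by move=> /le_ln1Dx; rewrite addrCA subrr addr0; lra.
Qed.

(* Abel summation of [sum_ln_prime_div_le] against [1 / ln p]. *)
Lemma prsum_le N : (2 <= N)%N -> prsum N <= ln (ln N%:R) + 13.
Proof.
pose A (n : nat) : R := \sum_(1 <= p < n.+1 | prime p) ln p%:R / p%:R.
have ASE n : A n.+1 = A n + (prime n.+1)%:R * ln n.+1%:R / n.+1%:R.
  rewrite /A big_mkcond /= big_nat_recr //= -big_mkcond /=.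
  by case: (prime _); rewrite ?mul1r ?mul0r.
have l2 : 1 / 2 <= ln 2 :> R.
  have := @le_ln1Dx R (- (1 / 2)).
  have -> : 1 + - (1 / 2) = 2^-1 :> R by lra.
  by rewrite lnV ?posrE //; lra.
have l21 : ln 2 <= 1 :> R by have := @le_ln1Dx R 1; rewrite (_ : 1 + 1 = 2) //; lra.
have pr2 : prsum 2 = 2^-1 by rewrite /prsum unlock /= addr0.
have A2 : A 2 = ln 2 / 2 by rewrite /A unlock /= addr0.
have ll2 : -1 <= ln (ln 2) :> R.
  have := @le_ln1Dx R ((ln 2)^-1 - 1); rewrite addrCA subrr addr0.
  rewrite lnV ?posrE; last lra.
  have : (ln 2)^-1 <= 2 :> R by rewrite invf_ple ?posrE //; lra.
  by have : 0 < (ln 2)^-1 :> R; [rewrite invr_gt0; lra|lra].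
(* The 9 pays for the start [M = 2], where [ln (ln 2) >= -1] and [4 / ln 2 <= 8]. *)
have key M : (2 <= M)%N -> prsum M <= A M / ln M%:R + (ln (ln M%:R) - 4 / ln M%:R) + 9.
  elim: M => // M IH; rewrite leq_eqVlt => /orP[/eqP [<-]|M2].
    rewrite pr2 A2.
    have -> : ln 2 / 2 / ln 2 = 2^-1 :> R by field; rewrite gt_eqF //; lra.
    have : 4 / ln 2 <= 8 :> R by rewrite ler_pdivrMr; lra.
    by lra.
  have {}IH := IH M2.
  have a0 : 0 < ln M%:R :> R by rewrite ln_gt0 // ltr1n.
  have ab : ln M%:R <= ln M.+1%:R :> R by rewrite ler_ln ?posrE ?ltr0n ?ler_nat //; lia.
  have b0 : 0 < ln M.+1%:R :> R by lra.
  have := lnS_gap_div M2; have := @sum_ln_prime_div_le M; rewrite -/(A M).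
  move=> /(_ (ltnW M2)) h1 h2.
  have d0 : 0 <= 1 / ln M%:R - 1 / ln M.+1%:R :> R.
    by rewrite subr_ge0 !div1r lef_pV2 ?posrE.
  have := ler_wpM2r d0 h1.
  rewrite prsumS ASE.
  have -> : (A M + (prime M.+1)%:R * ln M.+1%:R / M.+1%:R) / ln M.+1%:R =
     A M / ln M%:R - A M * (1 / ln M%:R - 1 / ln M.+1%:R) + (prime M.+1)%:R / M.+1%:R.
    by field; rewrite !gt_eqF.
  move: IH h2; set D := 1 / _ - 1 / _; set p := _ / M.+1%:R.
  set x := A M / _; set y := 4 / ln M%:R; set z := 4 / _.
  by move: (A M * D) ((ln M%:R + 4) * D) p x y z => *; lra.
move=> N2; apply: le_trans (key _ N2) _.
have a0 : 0 < ln N%:R :> R by rewrite ln_gt0 // ltr1n.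
have := @sum_ln_prime_div_le N (ltnW N2); rewrite -/(A N) => h.
have : A N / ln N%:R <= 1 + 4 / ln N%:R.
  by rewrite ler_pdivrMr // mulrDl mul1r mulfVK ?gt_eqF.
by lra.
Qed.

End VonMangoldt.


(** * Sums over squarefree numbers *)

(* A squarefree number is encoded by the decreasing list of its prime factors,
   an element of [subs (plist n)]. *)
Fixpoint plist (n : nat) : seq nat :=
  if n is m.+1 then (if prime n then n :: plist m else plist m) else [::].

Fixpoint subs (s : seq nat) : seq (seq nat) :=
  if s is p :: s' then subs s' ++ map (cons p) (subs s') else [:: [::]].

Definition prodl (I : seq nat) : nat := \prod_(p <- I) p.

Lemma mem_plist n p : (p \in plist n) = prime p && (p <= n)%N.
Proof.
elim: n => [|n IH] /=; first by rewrite in_nil; case: p => [|p]; rewrite ?andbF.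
case: ifP => pn; rewrite ?in_cons IH [in RHS]leq_eqVlt ltnS.
  by case: eqP => [->|] /=; rewrite ?pn.
by case: eqP => [->|]; rewrite ?pn.
Qed.

Lemma plist_sorted n : sorted gtn (plist n).
Proof.
elim: n => // n IH /=; case: ifP => // pn; rewrite /= path_min_sorted //.
by apply/allP => p; rewrite mem_plist => /andP[_ pn'] /=; lia.
Qed.

Lemma plist_uniq n : uniq (plist n).
Proof.
apply: (@sorted_uniq _ gtn); [|exact: ltnn|exact: plist_sorted].
by move=> a b c /= ab bc; lia.
Qed.

Lemma filter_subs (a : pred nat) s : [seq x <- s | a x] \in subs s.
Proof.
elim: s => // p s IH /=; rewrite mem_cat; case: ifP => _; last by rewrite IH.
by rewrite map_f ?orbT.
Qed.

Lemma subs_subseq s I : I \in subs s -> subseq I s.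
Proof.
elim: s I => [|p s IH] I /=; first by rewrite inE => /eqP ->.
rewrite mem_cat => /orP[/IH h|/mapP[J /IH h ->]].
  by apply: subseq_trans h (subseq_cons _ _).
by rewrite /= eqxx.
Qed.

Lemma subs_plist_prime n I p : I \in subs (plist n) -> p \in I -> prime p && (p <= n)%N.
Proof. by move=> /subs_subseq /mem_subseq h /h; rewrite mem_plist. Qed.

Lemma prodl_gt0 n I : I \in subs (plist n) -> (0 < prodl I)%N.
Proof.
move=> In; rewrite /prodl big_seq; apply: prodn_cond_gt0 => p pI.
by have /andP[/prime_gt0] := subs_plist_prime In pI.
Qed.

Lemma prodn_gt0_seq (s : seq nat) (F : nat -> nat) :
  (forall p, p \in s -> 0 < F p)%N -> (0 < \prod_(p <- s) F p)%N.
Proof. by move=> h; rewrite big_seq; apply: prodn_cond_gt0. Qed.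

Lemma prod_primes_logn n (s : seq nat) : (0 < n)%N -> uniq s ->
  {subset primes n <= s} -> n = (\prod_(p <- s) p ^ logn p n)%N.
Proof.
move=> n0 us sub; rewrite [LHS](prod_prime_decomp n0) prime_decompE big_map /=.
rewrite [RHS](bigID (fun p => p \in primes n)) /= [X in (_ * X)%N]big1 ?muln1; last first.
  by move=> p; rewrite -logn_gt0 lt0n negbK => /eqP ->.
rewrite -[RHS]big_filter; apply/perm_big/uniq_perm; rewrite ?filter_uniq ?primes_uniq //.
move=> p; rewrite mem_filter; case E : (p \in primes n) => //=.
by rewrite sub.
Qed.

Lemma square_squarefree_decomp n N : (0 < n <= N)%N ->
  exists w I, [/\ I \in subs (plist N), (0 < w <= n)%N & n = (w ^ 2 * prodl I)%N].
Proof.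
move=> /andP[n0 nN].
exists (\prod_(p <- plist N) p ^ (logn p n)./2)%N, [seq p <- plist N | odd (logn p n)].
set w := (\prod_(p <- plist N) _)%N; set I := [seq p <- _ | _].
have w0 : (0 < w)%N.
  by apply: prodn_gt0_seq => p; rewrite mem_plist expn_gt0 => /andP[/prime_gt0 ->].
have In : I \in subs (plist N) by exact: filter_subs.
have E : n = (w ^ 2 * prodl I)%N.
  rewrite {1}(@prod_primes_logn n (plist N)) ?plist_uniq //; last first.
    move=> p; rewrite mem_primes mem_plist => /and3P[-> _ /dvdn_leq h] /=.
    by rewrite (leq_trans (h n0)).
  rewrite /prodl big_filter [X in (_ * X)%N]big_mkcond /w expnS expn1 -!big_split /=.
  apply: eq_bigr => p _; rewrite -expnD addnn -[in LHS](odd_double_half (logn p n)) expnD mulnC.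
  by case: (odd _) => //=; rewrite expn0.
split => //; rewrite w0 /=; apply: leq_trans (_ : w ^ 2 * prodl I <= _)%N; last by rewrite -E.
by have := prodl_gt0 In; nia.
Qed.

Section SubsetSums.
Context {R : realType}.

Lemma sum_subs_cons p s (F : seq nat -> R) :
  \sum_(I <- subs (p :: s)) F I =
  \sum_(I <- subs s) F I + \sum_(I <- subs s) F (p :: I).
Proof. by rewrite /= big_cat big_map. Qed.

Lemma sum_subs_prod (y : nat -> R) s :
  \sum_(I <- subs s) \prod_(p <- I) y p = \prod_(p <- s) (1 + y p).
Proof.
elim: s => [|p s IH]; first by rewrite /= big_seq1 !big_nil.
rewrite sum_subs_cons big_cons -IH mulrDl mul1r mulr_sumr; congr (_ + _).
by apply: eq_bigr => I _; rewrite big_cons.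
Qed.

Lemma prod1D_le_expR (y : nat -> R) s : (forall p, 0 <= y p) ->
  0 <= \prod_(p <- s) (1 + y p) <= expR (\sum_(p <- s) y p).
Proof.
move=> y0; elim: s => [|p s /andP[IH0 IH]]; first by rewrite !big_nil expR0 ler01 lexx.
rewrite !big_cons expRD; have yp := y0 p; rewrite mulr_ge0 //=; last by lra.
by rewrite ler_pM ?expR_ge1Dx //; lra.
Qed.

Lemma sum_subs_prod_le (y : nat -> R) s : (forall p, 0 <= y p) ->
  \sum_(I <- subs s) \prod_(p <- I) y p <= expR (\sum_(p <- s) y p).
Proof. by move=> y0; rewrite sum_subs_prod; case/andP: (prod1D_le_expR s y0). Qed.

(** By linearity in [l]: an entry [p] contributes [l p * y p] times the product of [1 + y q] over
    the other [q], which the exponential bounds. *)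
Lemma sum_subs_prod_weight_le (y l : nat -> R) s :
  (forall p, 0 <= y p) -> (forall p, 0 <= l p) ->
  \sum_(I <- subs s) (\prod_(p <- I) y p) * (\sum_(p <- I) l p) <=
  expR (\sum_(p <- s) y p) * \sum_(p <- s) l p * y p.
Proof.
move=> y0 l0; elim: s => [|p s IH]; first by rewrite /= big_seq1 !big_nil !mulr0.
have yp := y0 p; have lp := l0 p.
rewrite sum_subs_cons [\sum_(p <- p :: s) l _ * _]big_cons.
under [X in _ + X]eq_bigr => I _ do rewrite !big_cons.
set T := \sum_(I <- _) _ in IH *; set U := \sum_(p <- s) _ * _ in IH *.
have -> : \sum_(I <- subs s) y p * \prod_(j <- I) y j * (l p + \sum_(j <- I) l j) =
   y p * l p * (\sum_(I <- subs s) \prod_(j <- I) y j) + y p * T.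
  by rewrite !mulr_sumr -big_split /=; apply: eq_bigr => I _; ring.
have h := sum_subs_prod_le s y0; have e1 := expR_ge1Dx (y p).
rewrite big_cons expRD; set e := expR (\sum_(p <- s) _) in h IH *.
have U0 : 0 <= U by apply: sumr_ge0 => j _; rewrite mulr_ge0.
have e0 : 0 <= e by exact: expR_ge0.
have step1 : T + y p * T <= (1 + y p) * (e * U) by rewrite -{1}[T]mul1r -mulrDl ler_wpM2l //; lra.
have step2 : (1 + y p) * (e * U) <= expR (y p) * (e * U) by rewrite ler_wpM2r ?mulr_ge0.
have ylp : 0 <= y p * l p by rewrite mulr_ge0.
have step3 : y p * l p * (\sum_(I <- subs s) \prod_(j <- I) y j) <= y p * l p * (expR (y p) * e).
  rewrite ler_wpM2l // (le_trans h) // ler_peMl //; lra.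
by rewrite mulrDr; move: step1 step2 step3; lra.
Qed.

Lemma sum_plist (F : nat -> R) n :
  \sum_(p <- plist n) F p = \sum_(1 <= p < n.+1 | prime p) F p.
Proof.
elim: n => [|n IH]; first by rewrite big_nil big_geq.
rewrite [RHS]big_mkcond big_nat_recr //= -big_mkcond /= -IH.
by case: ifP => pn; rewrite ?big_cons ?addr0 // addrC.
Qed.

Lemma prsumE n : prsum n = \sum_(p <- plist n) p%:R^-1 :> R.
Proof. by rewrite sum_plist. Qed.

Lemma natr_prodl I : (prodl I)%:R = \prod_(p <- I) p%:R :> R.
Proof. by rewrite /prodl natr_prod. Qed.

Lemma invr_prodl I : (prodl I)%:R^-1 = \prod_(p <- I) p%:R^-1 :> R.
Proof. by rewrite natr_prodl prodfV. Qed.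

Lemma sum_square_decomp_le (f : nat -> R) N : (forall m, 0 <= f m) ->
  \sum_(1 <= m < N.+1) f m <=
  \sum_(1 <= w < N.+1) \sum_(I <- subs (plist N)) f (w ^ 2 * prodl I)%N.
Proof.
move=> f0.
apply: le_trans (_ : \sum_(1 <= m < N.+1) \sum_(1 <= w < N.+1) \sum_(I <- subs (plist N))
   (m == w ^ 2 * prodl I)%N%:R * f m <= _).
  apply: ler_sum_nat => m mN.
  have [w [I [In /andP[w0 wm] E]]] := @square_squarefree_decomp m N mN.
  have t0 w' I' : 0 <= (m == w' ^ 2 * prodl I')%N%:R * f m by rewrite mulr_ge0.
  rewrite (bigD1_seq w) ?iota_uniq //=; last by rewrite mem_index_iota; lia.
  have eE : (m == w ^ 2 * prodl I)%N by apply/eqP.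
  rewrite (big_rem I) //= eE mul1r -addrA lerDl addr_ge0 //.
    by apply: sumr_ge0.
  by apply: sumr_ge0 => w' _; apply: sumr_ge0.
rewrite exchange_big /=; apply: ler_sum => w _.
rewrite exchange_big /=; apply: ler_sum => I _.
set k := (w ^ 2 * _)%N.
have [kN|kN] := boolP (k \in index_iota 1 N.+1).
  rewrite (bigD1_seq k) ?iota_uniq //= eqxx mul1r big1 ?addr0 //.
  by move=> i /negbTE ->; rewrite mul0r.
rewrite big1_seq // => i /= iN; case: eqP => [Ei|]; last by rewrite mul0r.
by rewrite -Ei iN in kN.
Qed.

Lemma ln_le_sqrt (w : nat) : (0 < w)%N -> 1 + 2 * ln w%:R <= 4 * Num.sqrt w%:R :> R.
Proof.
move=> w0; have w1 : 0 < w%:R :> R by rewrite ltr0n.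
have s0 : 0 < Num.sqrt w%:R :> R by rewrite sqrtr_gt0.
have : ln w%:R = 2 * ln (Num.sqrt w%:R) :> R.
  by rewrite mulr_natl -lnXn // sqr_sqrtr.
have := @le_ln1Dx R (Num.sqrt w%:R - 1); rewrite addrCA subrr addr0.
by move=> h ->; have := h ltac:(lra); lra.
Qed.

(** The numerator is [1 + ln (w^2)]: the loss incurred when the square part is put into the factor
    [s] of the cluster bound. *)
Lemma sum_ln_div_sqr N : \sum_(1 <= w < N.+1) (1 + 2 * ln w%:R) / (w ^ 2)%:R <= 12 :> R.
Proof.
have [->|N0] := posnP N; first by rewrite big_geq.
(* Strengthened for the induction: a new summand is at most [4 * w^(-3/2)], below the increment of
   [- 8 / sqrt w]. *)
suff : \sum_(1 <= w < N.+1) (1 + 2 * ln w%:R) / (w ^ 2)%:R <= 12 - 8 / Num.sqrt N%:R :> R.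
  by move=> /le_trans; apply; rewrite gerBl divr_ge0.
case: N N0 => // N _; elim: N => [|N IH].
  by rewrite big_nat1 ln1 sqrtr1; lra.
rewrite big_nat_recr //=.
set a := Num.sqrt N.+1%:R in IH; set b := Num.sqrt N.+2%:R.
have a0 : 0 < a by rewrite sqrtr_gt0 ltr0n.
have ab : a <= b by rewrite ler_sqrt ?ler_nat ?ltr0n.
have b0 : 0 < b by lra.
have aE : a ^+ 2 = N.+1%:R by rewrite sqr_sqrtr.
have bE : b ^+ 2 = N.+2%:R by rewrite sqr_sqrtr.
have ba : b ^+ 2 = a ^+ 2 + 1 by rewrite bE aE natr1.
have : (1 + 2 * ln N.+2%:R) / (N.+2 ^ 2)%:R <= 4 * b / (b ^+ 2) ^+ 2.
  by rewrite natrX -bE ler_pM2r ?ln_le_sqrt // ?invr_gt0 ?exprn_gt0 // bE ln_le_sqrt.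
move=> h; apply: le_trans (lerD IH h) _.
suff : 4 * b / (b ^+ 2) ^+ 2 <= 8 / a - 8 / b.
  by move: (_ / (b ^+ 2) ^+ 2) (8 / a) (8 / b) => x y z; lra.
have -> : 4 * b / (b ^+ 2) ^+ 2 = 4 / b ^+ 3 by field; rewrite gt_eqF.
have -> : 8 / a - 8 / b = 8 / (a * b * (a + b)).
  have : b - a = 1 / (a + b).
    apply: (@mulIf _ (a + b)); first by rewrite gt_eqF //; lra.
    by rewrite mulfVK ?gt_eqF //; [ring: ba|lra].
  move=> hba; transitivity (8 * (b - a) / (a * b)); first by field; rewrite !gt_eqF.
  by rewrite hba; field; rewrite !gt_eqF //; lra.
rewrite ler_pdivrMr ?exprn_gt0 // mulrAC ler_pdivlMr ?mulr_gt0 //; last lra.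
by have : a * b * (a + b) <= b * b * (b + b); [rewrite !ler_pM // ?mulr_ge0 //; lra|rewrite !exprS expr0; lra].
Qed.

(** The lower Mertens bound, [ln (ln N) <= prsum N + O(1)], in Euler's way: the harmonic sum is at
    most the sum over squares times the sum over squarefree numbers. The bound 12 for the squares
    comes from [sum_ln_div_sqr]. *)
Lemma ln_le_expR_prsum N : ln N%:R <= 24 * expR (prsum N) :> R.
Proof.
have [->|N0] := posnP N; first by rewrite ln0 // mulr_ge0 ?expR_ge0.
apply: (@le_trans _ _ (2 * \sum_(1 <= m < N.+1) m%:R^-1)).
  case: N N0 => // N _; elim: N => [|N IH]; first by rewrite ln1 mulr_ge0 ?sumr_ge0.
  rewrite big_nat_recr //= mulrDr.
  have := @ln_natS_gap R N.+1 isT.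
  have : N.+1%:R^-1 <= 2 * N.+2%:R^-1 :> R.
    by rewrite ler_pdivlMr // mulrC ler_pdivrMr // -!natrM ler_nat; lia.
  move: IH; move: (ln _) (ln _) (2 * \sum_(1 <= i < N.+2) _) (2 / _) (N.+1%:R^-1) => x y z t v.
  by lra.
rewrite (_ : 24 = 2 * 12); last lra.
rewrite -mulrA ler_pM2l //.
apply: le_trans (@sum_square_decomp_le (fun m => m%:R^-1) N _) _ => [m|]; first by rewrite invr_ge0.
apply: le_trans (_ : \sum_(1 <= w < N.+1) (1 + 2 * ln w%:R) / (w ^ 2)%:R * expR (prsum N) <= _).
  apply: ler_sum_nat => w /andP[w0 _].
  have l0 : 0 <= ln w%:R :> R by rewrite ln_ge0 // ler1n.
  have e : \sum_(I <- subs (plist N)) (prodl I)%:R^-1 <= expR (prsum N) :> R.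
    rewrite prsumE; under eq_bigr do rewrite invr_prodl.
    by apply: sum_subs_prod_le => p; rewrite invr_ge0.
  under eq_bigr do rewrite natrM invfM.
  rewrite -mulr_sumr ler_pM ?sumr_ge0 ?invr_ge0 //.
  by rewrite ler_peMl ?invr_ge0 //; lra.
by rewrite -mulr_suml ler_wpM2r ?expR_ge0 // sum_ln_div_sqr.
Qed.

End SubsetSums.


(** * The barrier estimate *)

Section Barrier.
Context {R : realType}.

Notation c := (@ln R 2).
Notation b := (@ln R (@ln R 2)).

Lemma ln2_bounds : 7 / 12 <= c <= 3 / 4.
Proof.
apply/andP; split.
  (* From [1/2 = (3/4) (2/3)]; the upper bound below uses [2 <= (9/8)^6]. *)
  have h1 := @le_ln1Dx R (- (1 / 4)) ltac:(lra).
  have h2 := @le_ln1Dx R (- (1 / 3)) ltac:(lra).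
  have : ln ((1 + - (1 / 4)) * (1 + - (1 / 3))) = - c :> R.
    by rewrite -lnV ?posrE //; congr ln; field.
  by rewrite lnM ?posrE; lra.
have h := @le_ln1Dx R (1 / 8) ltac:(lra).
have p0 : 0 < 1 + 1 / 8 :> R by lra.
have : c <= ln ((1 + 1 / 8) ^+ 6) :> R.
  by rewrite ler_ln ?posrE ?exprn_gt0 // !exprS expr0; lra.
by rewrite lnXn; lra.
Qed.

(** The decay rates of the Rankin bounds are positive: [c + b = ln (2 * c)] for sizes below the
    critical [X / c], and [- b] above it. *)
Lemma lnln2_bounds : b <= - (1 / 4) /\ 1 / 7 <= c + b.
Proof.
have /andP[c1 c2] := ln2_bounds; have c0 : 0 < c by lra.
split.
  have := @le_ln1Dx R (c - 1) ltac:(lra).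
  by rewrite addrCA subrr addr0; lra.
have i0 : 0 < (2 * c)^-1 by rewrite invr_gt0; lra.
have := @le_ln1Dx R ((2 * c)^-1 - 1) ltac:(lra).
rewrite addrCA subrr addr0 lnV ?posrE ?lnM ?posrE; try lra.
have : (2 * c)^-1 <= 6 / 7.
  by rewrite -[leLHS]div1r ler_pdivrMr; lra.
lra.
Qed.

Lemma natr2 (n : nat) : n.+2%:R = n%:R + 2 :> R.
Proof. by rewrite -addn2 natrD. Qed.

Lemma Bernoulli_pow (y x : R) m : 0 <= y -> 0 <= x ->
  y ^+ m.+1 + m.+1%:R * x * y ^+ m <= (y + x) ^+ m.+1.
Proof.
move=> y0 x0; elim: m => [|m IH]; first by rewrite !expr1 expr0; lra.
rewrite [leRHS]exprS.
have yx : 0 <= y + x by lra.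
apply: le_trans (ler_wpM2l yx IH).
have h : 0 <= x * (m.+1%:R * x * y ^+ m) by rewrite !mulr_ge0 // exprn_ge0.
rewrite -[m.+2%:R]natr1 exprS [y ^+ m.+1]exprS.
by move: h; set z := y ^+ m; set w := m.+1%:R; lra.
Qed.

(* [barrier_poly u q k] solves [U_k' = U_(k-1)] and is nonnegative as long as
   [k <= y / c + u + 2]: it bounds the volume of the points
   [0 <= x_1 <= ... <= x_k <= y] lying above the line [x_j = (j - u) c]. *)
Definition barrier_poly (u q k : nat) (y : R) : R :=
  (y + (u.+2%:R - k%:R) * c) * (y + (q + u.+2)%:R * c) ^+ (k + q).-1 / (k + q)`!%:R.

(** An Abel polynomial: as [B - A] is [n + 2] times [c], the derivative of [A B^(n+1) / (n+2)!] is
    [(A + c) B^n / (n+1)!], the polynomial of the previous index. For [A >= 0] the increment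
    dominates [x] times this derivative, by [Bernoulli_pow]. *)
Lemma barrier_poly_step u q k (y x : R) : (0 < q)%N -> 0 <= y -> 0 <= x ->
  k.+1%:R * c <= y + u.+2%:R * c ->
  barrier_poly u q k.+1 y + x * barrier_poly u q k y <= barrier_poly u q k.+1 (y + x).
Proof.
have /andP[c1 c2] := ln2_bounds.
case: q => // q _ y0 x0 hk; rewrite /barrier_poly !addSn !addnS /=.
set n := (k + q)%N.
have f0 : 0 < (n.+1)`!%:R :> R by rewrite ltr0n fact_gt0.
rewrite [(n.+2)`!]factS natrM.
set F := n.+1`!%:R; set N2 := n.+2%:R.
have N20 : 0 < N2 by rewrite ltr0n.
set A := y + (_ - k.+1%:R) * c; set Ax := y + x + (_ - k.+1%:R) * c.
set A' := y + (_ - k%:R) * c; set B := y + _ * c; set Bx := y + x + _ * c.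
have AxE : Ax = A + x by rewrite /A /Ax; ring.
have BxE : Bx = B + x by rewrite /B /Bx; ring.
have A'E : A' = A + c by rewrite /A /A' -(natr1 k); ring.
have BE : B = A + N2 * c.
  rewrite /A /B /N2 /n (natr2 (k + q)) -(natr1 (q + u).+2) (natr2 (q + u)) (natr2 u) -(natr1 k) !natrD.
  by ring.
have A0 : 0 <= A by rewrite /A; lra.
have B0 : 0 <= B by rewrite BE addr_ge0 // mulr_ge0; lra.
rewrite AxE BxE A'E.
have N2E : N2 = n.+1%:R + 1 by rewrite natr1.
have key : A * B ^+ n.+1 + x * (A + c) * N2 * B ^+ n <= (A + x) * (B + x) ^+ n.+1.
  have h := @Bernoulli_pow B x n B0 x0.
  apply: le_trans (ler_wpM2l (addr_ge0 A0 x0) h).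
  have h2 : 0 <= n.+1%:R * x ^+ 2 * B ^+ n by rewrite !mulr_ge0 ?exprn_ge0.
  rewrite exprS; move: h2; rewrite [in X in _ -> X <= _]N2E.
  have -> : (A + x) * (B * B ^+ n + n.+1%:R * x * B ^+ n) =
     A * (B * B ^+ n) + x * (A + c) * (n.+1%:R + 1) * B ^+ n + n.+1%:R * x ^+ 2 * B ^+ n.
    by rewrite BE N2E; ring.
  lra.
have -> : A * B ^+ n.+1 / (N2 * F) + x * ((A + c) * B ^+ n / F) =
  (A * B ^+ n.+1 + x * (A + c) * N2 * B ^+ n) / (N2 * F).
  by field; rewrite !gt_eqF.
by rewrite ler_pM2r // invr_gt0 mulr_gt0.
Qed.

Lemma barrier_poly_ge0 u q k (y : R) : 0 <= y -> k%:R * c <= y + u.+2%:R * c ->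
  0 <= barrier_poly u q k y.
Proof.
have /andP[c1 c2] := ln2_bounds.
move=> y0 hk; rewrite /barrier_poly !mulr_ge0 ?invr_ge0 ?exprn_ge0 //; first by lra.
by rewrite addr_ge0 // mulr_ge0 //; lra.
Qed.

Lemma barrier_poly0_mono u q (y : R) : 0 <= y ->
  0 < barrier_poly u q 0 0 <= barrier_poly u q 0 y.
Proof.
have /andP[c1 c2] := ln2_bounds; have c0 : 0 < c by lra.
move=> y0; rewrite /barrier_poly !subr0 !add0r.
have u0 : 0 < u.+2%:R * c by rewrite mulr_gt0.
have qu0 : 0 < (q + u.+2)%:R * c by rewrite mulr_gt0 // addnS.
apply/andP; split; first by rewrite !mulr_gt0 ?invr_gt0 ?exprn_gt0 ?ltr0n ?fact_gt0.
rewrite ler_pM2r ?invr_gt0 ?ltr0n ?fact_gt0 //.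
have yu : u.+2%:R * c <= y + u.+2%:R * c by lra.
have yqu : (q + u.+2)%:R * c <= y + (q + u.+2)%:R * c by lra.
rewrite ler_pM ?exprn_ge0 ?(ltW u0) ?(ltW qu0) //.
by rewrite lerXn2r // nnegrE; lra.
Qed.

(* The prime factors p_1 < p_2 < ... satisfy j <= prsum p_j / c + u for all j.
   With [prsum] rather than [ln (ln p)] as the clock, sums over primes are lower
   Riemann sums, so that comparing with [barrier_poly] costs nothing. *)
Fixpoint below (u : nat) (I : seq nat) : bool :=
  if I is p :: J then below u J && ((size J).+1%:R <= prsum p / c + u%:R) else true.

Definition bsum (u n k : nat) : R :=
  \sum_(I <- subs (plist n)) ((size I == k) && below u I)%:R * \prod_(p <- I) p%:R^-1.

Lemma bsum_eq0 u n k : prsum n / c + u%:R < k%:R -> bsum u n k = 0.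
Proof.
have /andP[c1 c2] := ln2_bounds; have c0 : 0 < c by lra.
move=> hk; rewrite /bsum big1_seq // => I /= In.
case: eqP => [E|]; last by rewrite mul0r.
case: I E In => [|p J] /= E In.
  rewrite -E in hk; move: hk; rewrite ltNge addr_ge0 // divr_ge0 ?prsum_ge0 //; lra.
have /andP[pp pn] := subs_plist_prime In (mem_head _ _).
rewrite [X in _ && X](_ : _ = false) ?andbF ?mul0r //.
apply/negbTE; rewrite -ltNge E; apply: le_lt_trans hk.
by rewrite lerD2r ler_pM2r ?invr_gt0 // le_prsum.
Qed.

Lemma bsumS u n k : bsum u n.+1 k.+1 =
  if prime n.+1 then
    bsum u n k.+1 + ((k.+1%:R : R) <= prsum n.+1 / c + u%:R)%R%:R * (n.+1%:R^-1 * bsum u n k)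
  else bsum u n k.+1.
Proof.
rewrite /bsum /=; case: ifP => // pn.
rewrite [LHS](sum_subs_cons n.+1 (plist n)); congr (_ + _).
rewrite !mulr_sumr; apply: eq_bigr => I _; rewrite big_cons /= eqSS.
case: eqP => [->|] /=; last by rewrite !mul0r !mulr0.
by rewrite -mulnb natrM; ring.
Qed.

Lemma bsum0 u n : bsum u n 0 = 1.
Proof.
elim: n => [|n IH]; first by rewrite /bsum /= big_seq1 big_nil mulr1.
rewrite /bsum /=; case: ifP => // pn.
rewrite (sum_subs_cons n.+1 (plist n)) [X in _ + X]big1 ?addr0 // => I _.
by rewrite /= mul0r.
Qed.

(** Induction on the range of primes: the lists with largest prime [n.+1] add at most
    [bsum u n k / (n + 1)], which is [barrier_poly_step] with [x = 1 / (n + 1)]. The factor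
    [barrier_poly u q 0 0] normalizes the empty list. *)
Lemma bsum_le u q n k : (0 < q)%N -> k%:R <= prsum n / c + u%:R + 1 ->
  bsum u n k * barrier_poly u q 0 0 <= barrier_poly u q k (prsum n).
Proof.
have /andP[c1 c2] := ln2_bounds; have c0 : 0 < c by lra.
move=> q0.
have hc m (y : R) : m%:R <= y / c + u%:R + 1 -> m%:R * c + c <= y + u.+2%:R * c.
  move=> h; have := ler_wpM2r (ltW c0) h.
  rewrite (natr2 u) !mulrDl mulfVK ?gt_eqF //; lra.
elim: n k => [|n IH] k hk.
  case: k hk => [|k] hk.
    by rewrite bsum0 mul1r; case/andP: (@barrier_poly0_mono u q (prsum 0) (prsum_ge0 _)).
  rewrite /bsum /= big_seq1 /= mul0r mul0r barrier_poly_ge0 ?prsum_ge0 //.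
  by have := hc _ _ hk; lra.
case: k hk => [|k] hk.
  by rewrite bsum0 mul1r; case/andP: (@barrier_poly0_mono u q (prsum n.+1) (prsum_ge0 _)).
have [U0 _] := andP (@barrier_poly0_mono u q 0 (lexx _)).
have P0 := @prsum_ge0 R n.
have [kb|kb] := ltP (prsum n.+1 / c + u%:R) k.+1%:R.
  rewrite bsum_eq0 // mul0r barrier_poly_ge0 ?prsum_ge0 //.
  by have := hc _ _ hk; lra.
(* A prime moves the clock by at most [1/2 <= c]; hence the slack 1 in the hypothesis, which makes
   the induction hypothesis available at [n] when [k.+1] respects the barrier at [n.+1]. *)
have nk : k.+1%:R <= prsum n / c + u%:R + 1.
  apply: le_trans kb _; rewrite prsumS mulrDl -!addrA lerD2l addrC lerD2l.
  rewrite ler_pdivrMr // mul1r; case: (boolP (prime n.+1)) => pn; last by rewrite mul0r; lra.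
  have : 2%:R <= n.+1%:R :> R by rewrite ler_nat prime_gt1.
  move=> h; apply: le_trans (_ : 2^-1 <= _); last by lra.
  by rewrite mul1r lef_pV2 ?posrE.
have h1 := IH _ nk.
rewrite bsumS; case: ifP => pn; last first.
  by rewrite prsumS pn mul0r addr0.
rewrite kb mul1r.
have nk' : k%:R <= prsum n / c + u%:R + 1 by apply: le_trans nk; rewrite ler_nat.
have h2 := IH _ nk'.
have i0 : 0 <= n.+1%:R^-1 :> R by rewrite invr_ge0.
have h3 := @barrier_poly_step u q k (prsum n) (n.+1%:R^-1) q0 P0 i0.
rewrite prsumS pn mul1r; apply: le_trans (h3 _); last by have := hc _ _ nk; lra.
rewrite mulrDl lerD //.
by rewrite -mulrA ler_wpM2l.
Qed.

Lemma pow_le_fact_expR (x : R) n : 0 <= x -> x ^+ n / n`!%:R <= expR x.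
Proof.
case: n => [|n] x0; first by rewrite expr0 fact0 divr1 -expR0 ler_expR.
by apply: le_trans (expR_ge1Dxn n x0); rewrite lerDr.
Qed.

Lemma expR1_le_pow (m : nat) : (0 < m)%N -> expR 1 <= (1 + m%:R^-1) ^+ m.+1 :> R.
Proof.
move=> m0; have m1 : 0 < m%:R :> R by rewrite ltr0n.
have p : 0 < 1 + m%:R^-1 :> R by rewrite addr_gt0 ?invr_gt0.
rewrite -[leRHS]lnK ?posrE ?exprn_gt0 // ler_expR lnXn //.
have : 1 + m%:R^-1 = (1 - m.+1%:R^-1)^-1 :> R.
  have h : m.+1%:R = m%:R + 1 :> R by rewrite natr1.
  by rewrite h; field; rewrite !gt_eqF //; lra.
have i1 : m.+1%:R^-1 < 1 :> R by rewrite invf_lt1 ?ltr0n // ltr1n ltnS.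
have i0 : 0 < m.+1%:R^-1 :> R by rewrite invr_gt0.
have i2 : 0 < 1 - m.+1%:R^-1 :> R by rewrite subr_gt0.
move=> ->; rewrite lnV ?posrE //.
have := @le_ln1Dx R (- m.+1%:R^-1); rewrite ltrN2 => /(_ i1).
rewrite -[- _ *+ _]mulr_natl mulrN => h; have := @ler_wpM2l R m.+1%:R (ler0n _ _) _ _ h.
by rewrite mulrN mulfV ?pnatr_eq0 // lerNr.
Qed.

Lemma fact_le_expR q : (0 < q)%N -> q`!%:R <= q%:R ^+ q.+1 * expR (1 - q%:R) :> R.
Proof.
case: q => // q _; elim: q => [|q IH]; first by rewrite subrr expR0 expr1n mulr1.
rewrite factS natrM.
have h := @expR1_le_pow q.+1 isT.
have q0 : 0 < q.+1%:R :> R by [].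
have q20 : 0 < q.+2%:R :> R by [].
have := ler_wpM2l (ler0n R q.+2) IH.
move=> /le_trans; apply.
have -> : 1 - q.+1%:R = expR 0 * 0 + (1 - q.+2%:R) + 1 :> R by rewrite -[q.+2%:R]natr1; ring.
rewrite mulr0 add0r expRD.
have e0 : 0 <= expR (1 - q.+2%:R) :> R by exact: expR_ge0.
rewrite mulrA [leRHS]mulrC [_ * (_ * _)]mulrA [leLHS](_ : _ = expR (1 - q.+2%:R) * (q.+2%:R * q.+1%:R ^+ q.+2 * expR 1)); last by ring.
rewrite ler_wpM2l //.
have -> : q.+2%:R ^+ q.+3 = q.+2%:R * q.+1%:R ^+ q.+2 * (1 + q.+1%:R^-1) ^+ q.+2 :> R.
  rewrite -mulrA -exprMn exprS; congr (_ * _ ^+ _).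
  by rewrite mulrDr mulr1 mulfV ?natr1 // gt_eqF.
by rewrite ler_wpM2l // mulr_ge0 ?exprn_ge0.
Qed.

(** With [q = v^2], [1 + v / q = 1 + 1 / v] and [q - 1 = (v + 1) (v - 1)], so [expR1_le_pow] gives
    [(1 + v / q)^(q - 1) >= exp (v - 1)]. Thus the shift by [v] recovers [exp v] up to a
    constant. *)
Lemma fact_le_shift (v : nat) : (0 < v)%N ->
  ((v ^ 2)`!)%:R <= v%:R ^+ 4 * expR 2 * (v ^ 2 + v)%:R ^+ (v ^ 2).-1 *
    expR (- (v ^ 2 + v)%:R) :> R.
Proof.
case: v => // w _; set v := w.+1; set q := (v ^ 2)%N.
have q0 : (0 < q)%N by rewrite expn_gt0.
have v0 : 0 < v%:R :> R by rewrite ltr0n.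
have qE : q = (q.-1).+1 by rewrite prednK.
have q1E : q.-1 = (v.+1 * w)%N by rewrite /q /v; nia.
have e1 : expR w%:R <= (1 + v%:R^-1) ^+ q.-1 :> R.
  rewrite q1E exprM -[w%:R]mul1r expRM_natr.
  by rewrite lerXn2r ?nnegrE ?expR_ge0 ?exprn_ge0 ?addr_ge0 ?invr_ge0 // expR1_le_pow.
have qv : (q + v)%:R ^+ q.-1 = q%:R ^+ q.-1 * (1 + v%:R^-1) ^+ q.-1 :> R.
  rewrite -exprMn mulrDr mulr1 natrD; congr ((_ + _) ^+ _).
  by rewrite /q natrX expr2 mulfK // gt_eqF.
apply: le_trans (fact_le_expR q0) _.
rewrite qv.
have -> : v%:R ^+ 4 = q%:R ^+ 2 :> R by rewrite /q natrX -exprM.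
have -> : q%:R ^+ q.+1 = q%:R ^+ q.-1 * q%:R ^+ 2 :> R by rewrite -exprD addn2 -qE.
set z := q%:R ^+ q.-1; set y := q%:R ^+ 2.
have -> : expR (1 - q%:R) = expR w%:R * expR 2 * expR (- (q + v)%:R) :> R.
  by rewrite -!expRD; congr expR; rewrite natrD /v -(natr1 w); ring.
rewrite [leRHS](_ : _ = z * y * ((1 + v%:R^-1) ^+ q.-1 * expR 2 * expR (- (q + v)%:R))); last by ring.
by rewrite ler_wpM2l ?mulr_ge0 ?exprn_ge0 // ler_wpM2r ?expR_ge0 // ler_wpM2r ?expR_ge0.
Qed.

(** For [k] within [u] of [X / c] the first factor is of order [u / X]: the ballot saving. The
    choice of [q] makes the cost of relaxing the barrier the cube of [u.+2] instead of an
    exponential in [u]. *)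
Lemma barrier_poly_ratio (u k : nat) (X : R) : 0 < X -> k%:R * c <= X + u.+2%:R * c ->
  barrier_poly u (u.+2 ^ 2) k X <=
  (X + (u.+2%:R - k%:R) * c) / X * (expR 2 * u.+2%:R ^+ 3) * expR (b * k%:R + X / c) *
    barrier_poly u (u.+2 ^ 2) 0 0.
Proof.
have /andP[c1 c2] := ln2_bounds; have c0 : 0 < c by lra.
move=> X0 hk; set v := u.+2; set q := (v ^ 2)%N.
have q0 : (0 < q)%N by rewrite expn_gt0.
rewrite /barrier_poly !subr0 !add0r add0n -/v.
set A := X + (v%:R - k%:R) * c.
have A0 : 0 <= A by rewrite /A /v; lra.
set B := X + (q + v)%:R * c.
have BX : X <= B by rewrite lerDl mulr_ge0 // ltW.
have B0 : 0 < B by exact: lt_le_trans BX.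
have v0 : 0 < v%:R :> R by [].
have qv0 : 0 < (q + v)%:R :> R by rewrite ltr0n addn_gt0 q0.
(* One more power of [B] is bought with [1 / X], as [X <= B]; what remains is [c^(k+q)] times a term
   of the exponential series at [B / c]. *)
have h1 : B ^+ (k + q).-1 / (k + q)`!%:R <= c ^+ (k + q) * expR (B / c) / X.
  rewrite ler_pdivlMr //.
  apply: le_trans (_ : B ^+ (k + q) / (k + q)`!%:R <= _).
    rewrite mulrAC ler_pM2r ?invr_gt0 ?ltr0n ?fact_gt0 //.
    rewrite -[in leRHS](@prednK (k + q)) ?addn_gt0 ?q0 ?orbT // exprSr.
    by rewrite ler_wpM2l // exprn_ge0 // ltW.
  have := @pow_le_fact_expR (B / c) (k + q) ltac:(by rewrite divr_ge0 // ltW).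
  have ck : 0 < c ^+ (k + q) by rewrite exprn_gt0.
  rewrite exprMn exprVn => h; rewrite -ler_pdivrMl //.
  by apply: le_trans h; rewrite le_eqVlt; apply/orP; left; apply/eqP; ring.
have f0 : 0 < q`!%:R :> R by rewrite ltr0n fact_gt0.
have h2 := @fact_le_shift v isT; rewrite -/q in h2.
have -> : A * B ^+ (k + q).-1 / (k + q)`!%:R = A * (B ^+ (k + q).-1 / (k + q)`!%:R) by rewrite mulrA.
apply: le_trans (ler_wpM2l A0 h1) _.
have -> : expR (b * k%:R + X / c) = c ^+ k * expR (X / c).
  by rewrite expRD expRM_natr lnK // posrE.
have -> : expR (B / c) = expR (X / c) * expR (q + v)%:R.
  by rewrite -expRD; congr expR; rewrite /B; field; rewrite gt_eqF.
have cq : c ^+ (k + q) = c ^+ k * c * c ^+ q.-1.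
  by rewrite -mulrA -exprS prednK // exprD.
rewrite cq exprMn.
set e := expR (X / c); set z := (q + v)%:R ^+ q.-1; set ck := c ^+ k; set cq1 := c ^+ q.-1.
set E := expR (q + v)%:R; set F := q`!%:R.
have z0 : 0 < z by rewrite exprn_gt0.
have E0 : 0 < E by exact: expR_gt0.
have key : F * E <= v%:R ^+ 4 * expR 2 * z.
  move: h2; rewrite -/F -/z expRN -/E => h2.
  by have := ler_wpM2r (ltW E0) h2; rewrite mulfVK // gt_eqF.
have -> : A * (ck * c * cq1 * (e * E) / X) = (A / X * ck * c * cq1 * e) * (F * E) / F.
  by field; rewrite !gt_eqF.
have -> : A / X * (expR 2 * v%:R ^+ 3) * (ck * e) * (v%:R * c * (z * cq1) / F) =
   (A / X * ck * c * cq1 * e) * (v%:R ^+ 4 * expR 2 * z) / F.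
  by field; rewrite !gt_eqF.
rewrite ler_pM2r ?invr_gt0 // ler_wpM2l // !mulr_ge0 ?invr_ge0 ?expR_ge0 ?exprn_ge0 // ltW //.
Qed.

Lemma bsum_bound (u n k : nat) : 0 < prsum n :> R -> k%:R <= prsum n / c + u%:R + 1 ->
  bsum u n k <= (prsum n + (u.+2%:R - k%:R) * c) / prsum n * (expR 2 * u.+2%:R ^+ 3) *
    expR (b * k%:R + prsum n / c).
Proof.
have /andP[c1 c2] := ln2_bounds; have c0 : 0 < c by lra.
move=> X0 hk.
have [U0 _] := andP (@barrier_poly0_mono u (u.+2 ^ 2) 0 (lexx _)).
rewrite -(ler_pM2r U0); apply: le_trans (bsum_le _ hk) _; first by rewrite expn_gt0.
apply: barrier_poly_ratio => //.
have := ler_wpM2r (ltW c0) hk; rewrite (natr2 u) !mulrDl mulfVK ?gt_eqF //; lra.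
Qed.

(** As [expR (- b * k) = c^(-k)], this tilts the weights [1 / p] so that a typical list has about
    [X / c] entries, the size at which [2^k] reaches [expR X], of order log Y. *)
Let wt (I : seq nat) : R := expR (- b * (size I)%:R) * \prod_(p <- I) p%:R^-1.

Let wt_ge0 I : 0 <= wt I.
Proof. by rewrite mulr_ge0 ?expR_ge0 // prodr_ge0 // => p _; rewrite invr_ge0. Qed.

Let wtE I : wt I = \prod_(p <- I) (p%:R^-1 / c).
Proof.
have /andP[c1 c2] := ln2_bounds; have c0 : 0 < c by lra.
rewrite /wt; elim: I => [|p I IH]; first by rewrite mulr0 expR0 !big_nil mulr1.
rewrite !big_cons -IH /= -(natr1 (size I)) mulrDr mulr1 expRD expRN lnK ?posrE //.
by ring.
Qed.

Let sum_wt Y : \sum_(I <- subs (plist Y)) wt I <= expR (prsum Y / c).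
Proof.
have /andP[c1 c2] := ln2_bounds; have c0 : 0 < c by lra.
under eq_bigr do rewrite wtE.
rewrite prsumE mulr_suml; apply: sum_subs_prod_le => p.
by rewrite divr_ge0 ?invr_ge0 // ltW.
Qed.

Lemma lnn_ge0 (n : nat) : 0 <= ln n%:R :> R.
Proof. case: n => [|n]; first by rewrite ln0.
by rewrite ln_ge0 // ler1n. Qed.

Let sum_wt_ln Y T (t : R) : (T <= Y)%N -> prsum T <= t -> 0 <= t ->
  \sum_(I <- subs (plist Y)) wt I * (1 + \sum_(p <- I | (p <= T)%N) ln p%:R) <=
  expR (prsum Y / c) * (57 * expR t).
Proof.
have /andP[c1 c2] := ln2_bounds; have c0 : 0 < c by lra.
move=> TY Tt t0.
have t1 : 1 <= expR t by rewrite -expR0 ler_expR.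
set e := expR (prsum Y / c).
have e0 : 0 <= e by exact: expR_ge0.
under eq_bigr => I _ do rewrite mulrDr mulr1 (big_mkcond (fun p => p <= T)%N) /=.
rewrite big_split /=.
have h1 := sum_wt Y.
pose l (p : nat) : R := if (p <= T)%N then ln p%:R else 0.
have l0 p : 0 <= l p by rewrite /l; case: ifP => // _; exact: lnn_ge0.
have y0 (p : nat) : 0 <= p%:R^-1 / c :> R by rewrite divr_ge0 ?invr_ge0 // ltW.
have h2 := sum_subs_prod_weight_le (plist Y) y0 l0.
have -> : \sum_(I <- subs (plist Y)) wt I * \sum_(p <- I) l p =
  \sum_(I <- subs (plist Y)) (\prod_(p <- I) (p%:R^-1 / c)) * \sum_(p <- I) l p.
  by apply: eq_bigr => I _; rewrite wtE.
rewrite -mulr_suml -prsumE -/e in h2.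
(* With [1 / c <= 2], Mertens and [ln T <= 24 * expR t] give [2 * (24 * expR t + 4)]; adding 1
   yields at most [57 * expR t]. *)
suff h3 : \sum_(p <- plist Y) l p * (p%:R^-1 / c) <= 8 + 48 * expR t.
  have := ler_wpM2l e0 h3; have := ler_wpM2l e0 t1; move: h1 h2; rewrite -/e.
  rewrite mulrDr mulr1 mulrCA => a1 a2 a3 a4.
  apply: le_trans (lerD a1 (le_trans a2 a4)) _.
  by rewrite [leRHS]mulrCA; move: (e * expR t) a3 => E; lra.
have [T0|T0] := posnP T.
  rewrite big1_seq ?addr_ge0 ?mulr_ge0 ?expR_ge0 // => p /=; rewrite mem_plist => /andP[pp _].
  rewrite (_ : l p = 0) ?mul0r // /l T0; case: p pp => //.
apply: le_trans (_ : 2 * (ln T%:R + 4) <= _); last first.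
  have := @ln_le_expR_prsum R T; have : expR (prsum T) <= expR t :> R by rewrite ler_expR.
  lra.
apply: le_trans (_ : 2 * (\sum_(1 <= p < T.+1 | prime p) ln p%:R / p%:R) <= _); last first.
  by rewrite ler_pM2l // sum_ln_prime_div_le.
rewrite sum_plist (big_cat_nat (n := T.+1)) //=.
rewrite [X in _ + X]big1_seq ?addr0; last first.
  move=> p /andP[_]; rewrite mem_index_iota => /andP[Tp _].
  by rewrite /l leqNgt Tp /= mul0r.
rewrite mulr_sumr big_seq_cond [leRHS]big_seq_cond; apply: ler_sum => p /andP[].
rewrite mem_index_iota ltnS => /andP[p0 pT] pp; rewrite /l pT.
have -> : ln p%:R * (p%:R^-1 / c) = (ln p%:R / p%:R) * c^-1 :> R by ring.
rewrite mulrC ler_wpM2r ?divr_ge0 ?lnn_ge0 //.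
by rewrite invf_ple ?posrE; lra.
Qed.

Let cutoff (Y t : nat) : nat := \max_(T < Y.+1 | (@prsum R T <= t%:R)%R) T.

Let cutoff_le Y t : (cutoff Y t <= Y)%N.
Proof. by apply/bigmax_leqP => T _; rewrite -ltnS. Qed.

Let prsum_cutoff Y t : @prsum R (cutoff Y t) <= t%:R.
Proof.
have p0 : @prsum R (ord0 : 'I_Y.+1) <= t%:R by rewrite /prsum big_geq.
rewrite /cutoff (bigop.bigmax_eq_arg ord0) //.
by case: arg_maxnP.
Qed.

Let cutoff_max Y t p : (p <= Y)%N -> @prsum R p <= t%:R -> (p <= cutoff Y t)%N.
Proof.
move=> pY pt; have pY1 : (p < Y.+1)%N by rewrite ltnS.
exact: (@leq_bigmax_cond _ (fun T : 'I_Y.+1 => (@prsum R T <= t%:R)%R) _ (Ordinal pY1)).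
Qed.

Let count_gt_le (I : seq nat) T :
  (count (fun p => T < p)%N I + count (fun p => p <= T)%N I = size I)%N.
Proof.
by rewrite -(count_predC (fun p => T < p)%N); congr (_ + _)%N; apply: eq_count => p /=; rewrite leqNgt.
Qed.

(** A list decreases strictly, so its [j]-th smallest entry has exactly [j] entries up to it, and a
    failed test in [below] becomes an excess in a count. *)
Let not_belowP Y u I : I \in subs (plist Y) -> ~~ below u I ->
  exists p, (p <= Y)%N /\ prsum p / c + u%:R < (count (fun q => q <= p)%N I)%:R.
Proof.
move=> In; have sI : sorted gtn I.
  apply: (subseq_sorted _ (subs_subseq In) (plist_sorted Y)).
  by move=> a b d /= ab bd; lia.
have {In} IY p : p \in I -> (p <= Y)%N by move=> /(subs_plist_prime In) /andP[].
elim: I sI IY => // p I IH sI IY; rewrite [below _ _]/= negb_and => /orP[h|h].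
  have [|q qI|q [qY hq]] := IH _ _ h.
  - exact: path_sorted sI.
  - by apply: IY; rewrite inE qI orbT.
  exists q; split => //; apply: lt_le_trans hq _.
  by rewrite ler_nat /= leq_addl.
exists p; split; first by apply: IY; rewrite mem_head.
rewrite -ltNge in h; apply: lt_le_trans h _.
rewrite ler_nat /= leqnn add1n ltnS.
have : all (gtn p) I by move: sI => /=; apply: order_path_min => a b d /= ab bd; lia.
by rewrite -size_filter => /allP h; rewrite (_ : [seq _ <- _ | _] = I) //; apply/all_filterP/allP => q /h /= /ltnW.
Qed.

Let inwin (u Y k : nat) : bool :=
  ((@prsum R Y / c - u%:R <= k%:R) && (k%:R <= @prsum R Y / c + u%:R))%R.

Let pow2E (n : nat) : (2 ^ n)%:R = expR (c * n%:R) :> R.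
Proof. by rewrite expRM_natr lnK ?posrE // natrX. Qed.

(* With k = |I|: Rankin's trick disposes of [k <= X / c - u] (first term) and
   [k >= X / c + u] (second term); if the barrier is crossed, at clock time about
   [t] say, the cluster bound [g1] gains a factor [2 ^ - u] (third term); the
   remaining [I] are controlled by [bsum_bound]. *)
Let pointwise (u Y : nat) (B : R) (g : seq nat -> R) (I : seq nat) (X := @prsum R Y)
    (E := expR (- b * (size I)%:R)) : 1 <= B ->
  (forall T, (T <= Y)%N -> g I <=
    (2 ^ count (fun p => T < p)%N I)%:R * (1 + \sum_(p <- I | (p <= T)%N) ln p%:R)) ->
  g I <= B * expR (prsum Y) -> I \in subs (plist Y) ->
  g I <= E * expR ((c + b) * (X / c - u%:R)) + E * (B * expR (X + b * (X / c + u%:R))) +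
    \sum_(t < (Num.truncn X).+2) expR ((c + b) * (X / c + u%:R) + 1 - t%:R - c * u%:R) *
        (E * (1 + \sum_(p <- I | (p <= cutoff Y t)%N) ln p%:R)) +
    (below u I && inwin u Y (size I))%:R * (B * (E * expR ((c + b) * (X / c)))).
Proof.
move=> B1 g1 g2 In.
have /andP[c1 c2] := ln2_bounds; have c0 : 0 < c by lra.
have [b1 cb] := lnln2_bounds.
have E0 : 0 <= E by exact: expR_ge0.
have X0 : 0 <= X by exact: prsum_ge0.
have l0 T : 0 <= \sum_(p <- I | (p <= T)%N) ln p%:R :> R by apply: sumr_ge0 => p _; exact: lnn_ge0.
set S1 := E * _; set S2 := E * _; set S3 := \sum_(t < _) _; set S4 := _%:R * _.
have S10 : 0 <= S1 by rewrite mulr_ge0 ?expR_ge0.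
have B0 : 0 <= B by lra.
have S20 : 0 <= S2 by rewrite !mulr_ge0 ?expR_ge0.
have S30 : 0 <= S3 by apply: sumr_ge0 => t _; rewrite !mulr_ge0 ?expR_ge0 // addr_ge0.
have S40 : 0 <= S4 by rewrite !mulr_ge0 ?expR_ge0.
set k := size I in E E0 S1 S2 S3 S4 S10 S20 S30 S40 *.
have gk : g I <= expR (c * k%:R).
  apply: le_trans (g1 0%N _) _ => //.
  rewrite [X in 1 + X]big1_seq ?addr0 ?mulr1 -?pow2E ?ler_nat ?leq_pexp2l ?count_size //.
  move=> p /andP[p0 pI]; have /andP[pp _] := subs_plist_prime In pI.
  by move: p0 pp; rewrite leqn0 => /eqP ->.
have [k_lo|k_lo] := ltP k%:R (X / c - u%:R).
  suff : g I <= S1 by lra.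
  apply: le_trans gk _; rewrite /S1 /E -expRD ler_expR.
  have := ler_wpM2l (_ : 0 <= c + b) (ltW k_lo); rewrite mulrDl => /(_ ltac:(lra)); lra.
have [k_hi|k_hi] := ltP (X / c + u%:R) k%:R.
  suff : g I <= S2 by lra.
  apply: le_trans g2 _; rewrite /S2 /E mulrCA -expRD ler_wpM2l // ler_expR -/X.
  have := ler_wpM2l (_ : 0 <= - b) (ltW k_hi) => /(_ ltac:(lra)); lra.
have [gd|bd] := boolP (below u I).
  suff : g I <= S4 by lra.
  rewrite /S4 gd /inwin k_lo k_hi mul1r /E -expRD.
  (* The bounds [2^k] and [B * expR X] meet, up to [B], at [k = X / c]; after multiplication by
     [expR (b * k)] both are largest there. *)
  have [kX|kX] := leP k%:R (X / c).
    apply: le_trans gk _; apply: le_trans (ler_peMl (expR_ge0 _) B1).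
    rewrite ler_expR.
    have := ler_wpM2l (_ : 0 <= c + b) kX; rewrite mulrDl => /(_ ltac:(lra)); lra.
  apply: le_trans g2 _; rewrite ler_wpM2l // ler_expR -/X.
  have := ler_wpM2l (_ : 0 <= - b) (ltW kX) => /(_ ltac:(lra)).
  have -> : (c + b) * (X / c) = X + b * (X / c) by field; rewrite gt_eqF.
  lra.
have [p [pY hp]] := not_belowP In bd.
(* The crossing time is rounded up to the integer [t], which costs the 1 in the exponent. Since
   [p <= cutoff Y t], more than [prsum p / c + u] entries lie up to the cutoff and drop out of the
   power of 2. *)
pose t := (Num.truncn (@prsum R p)).+1.
have pt : prsum p < t%:R :> R by exact: truncnS_gt.
have tp : t%:R - 1 <= prsum p :> R by rewrite /t -natr1 addrK truncn_le prsum_ge0.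
have tX : (t < (Num.truncn X).+2)%N by rewrite ltnS /t ltnS le_truncn // le_prsum.
suff : g I <= S3 by lra.
apply: le_trans (_ : expR ((c + b) * (X / c + u%:R) + 1 - t%:R - c * u%:R) *
        (E * (1 + \sum_(p <- I | (p <= cutoff Y t)%N) ln p%:R)) <= _); last first.
  rewrite /S3 (bigD1 (Ordinal tX)) //= lerDl; apply: sumr_ge0 => s _.
  by rewrite !mulr_ge0 ?expR_ge0 // addr_ge0.
apply: le_trans (g1 _ (cutoff_le Y t)) _.
rewrite mulrA ler_wpM2r ?addr_ge0 // pow2E -expRD ler_expR.
have ci := count_gt_le I (cutoff Y t); rewrite -/k in ci.
have le_i : (count (fun q => q <= p) I <= count (fun q => q <= cutoff Y t) I)%N.
  by apply: sub_count => q /= /leq_trans; apply; apply: cutoff_max => //; exact: ltW.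
set i := count _ I in ci; set i' := count (fun q => _ <= cutoff _ _)%N _ in ci le_i.
have -> : i%:R = k%:R - i'%:R :> R by rewrite -ci natrD addrK.
have hi : prsum p / c + u%:R < i'%:R by apply: lt_le_trans hp _; rewrite ler_nat.
have := ler_wpM2l (_ : 0 <= c + b) k_hi; rewrite mulrDl => /(_ ltac:(lra)).
have := ler_wpM2l (ltW c0) (ltW hi); rewrite mulrDr [c * (_ / c)]mulrCA mulfV ?gt_eqF // mulr1.
lra.
Qed.

Let sum_window (u Y : nat) (d : R) : 0 < prsum Y :> R -> 0 <= d ->
  \sum_(I <- subs (plist Y)) (below u I && inwin u Y (size I))%:R * d * wt I <=
  (2 * u.+1%:R) * d * ((2 * u.+1%:R) / prsum Y * (expR 2 * u.+2%:R ^+ 3) * expR (prsum Y / c)).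
Proof.
move=> X0 d0; have /andP[c1 c2] := ln2_bounds; have c0 : 0 < c by lra.
set X := prsum Y in X0 *; set k1 := Num.truncn (X / c - u%:R).
set K := _ * expR (X / c).
have K0 : 0 <= K by rewrite !mulr_ge0 ?invr_ge0 ?expR_ge0 ?exprn_ge0 ?ltW.
apply: le_trans (_ : \sum_(I <- subs (plist Y)) \sum_(j < (2 * u.+1)%N)
   (inwin u Y (k1 + j))%:R * (((size I == k1 + j)%N && below u I)%:R * (d * wt I)) <= _).
  apply: ler_sum => I _.
  have dw : 0 <= d * wt I by rewrite mulr_ge0 ?wt_ge0.
  case: (boolP (_ && _)) => [/andP[bI wI]|_]; last first.
    by rewrite !mul0r; apply: sumr_ge0 => j _; do 2 apply: mulr_ge0 => //.
  have /andP[] := wI; rewrite -/X => w1 w2.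
  have k1k : (k1 <= size I)%N.
    rewrite /k1; have [h|h] := leP 0 (X / c - u%:R).
      by rewrite -(ler_nat R) (le_trans _ w1) // truncn_le.
    (* A negative lower end truncates to 0, so [k1] still bounds the size from below. *)
    by rewrite truncn_floor leNgt h.
  have kk : (size I - k1 < 2 * u.+1)%N.
    have h : X / c - u%:R < k1.+1%:R by exact: truncnS_gt.
    rewrite ltn_subLR // -(ltr_nat R) natrD natrM.
    rewrite -(natr1 k1) in h; rewrite -(natr1 u); apply: le_lt_trans w2 _; lra.
  rewrite (bigD1 (Ordinal kk)) //= subnKC // wI eqxx bI !mul1r lerDl.
  by apply: sumr_ge0 => j _; do 2 apply: mulr_ge0 => //.
rewrite exchange_big /=.
apply: le_trans (_ : \sum_(j < (2 * u.+1)%N) d * K <= _); last first.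
  by rewrite sumr_const card_ord -[leLHS]mulr_natl natrM mulrA.
apply: ler_sum => j _; rewrite -mulr_sumr; set k := (k1 + j)%N.
case: (boolP (inwin _ _ _)) => [/andP[w1 w2]|_]; last by rewrite mul0r mulr_ge0.
rewrite mul1r.
have -> : \sum_(I <- subs (plist Y)) ((size I == k) && below u I)%:R * (d * wt I) =
  d * expR (- b * k%:R) * bsum u Y k.
  rewrite /bsum mulr_sumr; apply: eq_bigr => I _; rewrite /wt.
  by case: eqP => [->|_] /=; [ring|rewrite !mul0r mulr0].
rewrite -mulrA ler_wpM2l //.
have kh : k%:R <= prsum Y / c + u%:R + 1 by apply: le_trans w2 _; rewrite lerDl.
rewrite -/X in w1 w2.
apply: le_trans (ler_wpM2l (expR_ge0 _) (bsum_bound X0 kh)) _.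
rewrite -/X mulrCA -expRD (_ : - b * k%:R + (b * k%:R + X / c) = X / c); last by ring.
rewrite /K ler_wpM2r ?expR_ge0 // ler_wpM2r ?mulr_ge0 ?expR_ge0 ?exprn_ge0 //.
rewrite ler_pM2r ?invr_gt0 //.
have h1 : X <= (k%:R + u%:R) * c by rewrite -ler_pdivrMr // -lerBlDr.
have : (2 * u%:R + 2) * c <= 2 * u%:R + 2 :> R.
  by rewrite ler_piMr ?addr_ge0 ?mulr_ge0 //; lra.
by rewrite (natr2 u) -(natr1 u); lra.
Qed.

(** [g] stays abstract: the argument uses only the cluster bound at every threshold [T] and one
    global bound, so it applies to each square part separately. *)
Theorem sum_squarefree_bound (u Y : nat) (B : R) (g : seq nat -> R) (X := @prsum R Y) :
  0 < prsum Y :> R -> 1 <= B ->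
  (forall I T, I \in subs (plist Y) -> (T <= Y)%N -> g I <=
    (2 ^ count (fun p => T < p)%N I)%:R * (1 + \sum_(p <- I | (p <= T)%N) ln p%:R)) ->
  (forall I, I \in subs (plist Y) -> g I <= B * expR (prsum Y)) ->
  \sum_(I <- subs (plist Y)) g I / (prodl I)%:R <=
    expR ((c + b) * (X / c) + X / c) *
    (expR (- (c + b) * u%:R) + B * expR (b * u%:R) +
     (Num.truncn X).+2%:R * (57 * expR 1) * expR (b * u%:R) +
     (2 * u.+1%:R) * B * ((2 * u.+1%:R) / X * (expR 2 * u.+2%:R ^+ 3))).
Proof.
move=> X0 B1 g1 g2.
have /andP[c1 c2] := ln2_bounds; have c0 : 0 < c by lra.
have B0 : 0 <= B by lra.
have W0 I : 0 <= (prodl I)%:R^-1 :> R by rewrite invr_ge0.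
have h I : I \in subs (plist Y) -> g I / (prodl I)%:R <=
  expR ((c + b) * (X / c - u%:R)) * wt I + (B * expR (X + b * (X / c + u%:R))) * wt I +
    \sum_(t < (Num.truncn X).+2) expR ((c + b) * (X / c + u%:R) + 1 - t%:R - c * u%:R) *
        (wt I * (1 + \sum_(p <- I | (p <= cutoff Y t)%N) ln p%:R)) +
    (below u I && inwin u Y (size I))%:R * (B * expR ((c + b) * (X / c))) * wt I.
  move=> In; have := pointwise u B1 (fun T => g1 I T In) (g2 I In) In.
  move=> /(ler_wpM2r (W0 I)) /le_trans; apply; rewrite le_eqVlt; apply/orP; left; apply/eqP.
  rewrite 3!mulrDl /wt -invr_prodl -/X.
  congr (_ + _ + _ + _); try ring.
  by rewrite mulr_suml; apply: eq_bigr => t _; ring.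
rewrite big_seq; apply: le_trans; first by apply: ler_sum => I In; exact: h.
rewrite -big_seq !big_split /=.
rewrite -!mulr_sumr exchange_big /=.
have s1 := sum_wt Y; rewrite -/X in s1.
have s2 := @sum_window u Y (B * expR ((c + b) * (X / c))) X0 ltac:(by rewrite mulr_ge0 ?expR_ge0).
set M := expR (_ + X / c); rewrite !(mulrDr M); rewrite -/X in s2.
have a1 : expR ((c + b) * (X / c - u%:R)) * (\sum_(i <- subs (plist Y)) wt i) <=
   M * expR (- (c + b) * u%:R).
  apply: le_trans (ler_wpM2l (expR_ge0 _) s1) _.
  by rewrite /M -!expRD ler_expR; lra.
have a2 : (B * expR (X + b * (X / c + u%:R))) * (\sum_(i <- subs (plist Y)) wt i) <=
   M * (B * expR (b * u%:R)).
  apply: le_trans (ler_wpM2l _ s1) _; first by rewrite mulr_ge0 ?expR_ge0.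
  rewrite [leRHS]mulrCA -mulrA ler_wpM2l // /M -!expRD ler_expR.
  have -> : (c + b) * (X / c) = X + b * (X / c) by field; rewrite gt_eqF.
  lra.
(* The [expR t] of [sum_wt_ln] cancels the [- t] in the exponent: every crossing time contributes
   the same, whence the factor [(Num.truncn X).+2]. *)
have a3 : \sum_(j < (Num.truncn X).+2) \sum_(i <- subs (plist Y))
    expR ((c + b) * (X / c + u%:R) + 1 - j%:R - c * u%:R) *
        (wt i * (1 + \sum_(p <- i | (p <= cutoff Y j)%N) ln p%:R)) <=
   M * ((Num.truncn X).+2%:R * (57 * expR 1) * expR (b * u%:R)).
  apply: le_trans (_ : \sum_(j < (Num.truncn X).+2) M * ((57 * expR 1) * expR (b * u%:R)) <= _); last first.
    rewrite sumr_const card_ord -[leLHS]mulr_natl le_eqVlt; apply/orP; left; apply/eqP.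
    by ring.
  apply: ler_sum => t _; rewrite -mulr_sumr.
  have := @sum_wt_ln Y (cutoff Y t) t%:R (cutoff_le Y t) (prsum_cutoff Y t) (ler0n _ _).
  move=> /(ler_wpM2l (expR_ge0 _)) /le_trans; apply; rewrite -/X.
  rewrite (_ : forall x y z : R, x * (y * (57 * z)) = 57 * (x * y * z)); last by move=> *; ring.
  rewrite [leRHS](_ : _ = 57 * (M * expR 1 * expR (b * u%:R))); last by ring.
  by rewrite ler_pM2l // /M -!expRD ler_expR; lra.
apply: le_trans (lerD (lerD (lerD a1 a2) a3) s2) _.
rewrite lerD2l le_eqVlt; apply/orP; left; apply/eqP; rewrite /M (expRD _ (X / c)).
by ring.
Qed.

End Barrier.


(** * Choosing the slack of the barrier *)

Section SumExists.
Context {R : realType}.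

Notation c := (@ln R 2).
Notation b := (@ln R (@ln R 2)).

Lemma sum_squarefree_bound_exp : exists2 C : R, 0 < C &
  forall (Y : nat) (B : R) (g : seq nat -> R),
  1 <= prsum Y :> R -> 1 <= B ->
  (forall I T, I \in subs (plist Y) -> (T <= Y)%N -> g I <=
    (2 ^ count (fun p => T < p)%N I)%:R * (1 + \sum_(p <- I | (p <= T)%N) ln p%:R)) ->
  (forall I, I \in subs (plist Y) -> g I <= B * expR (prsum Y)) ->
  \sum_(I <- subs (plist Y)) g I / (prodl I)%:R <=
    C * B * expR ((c + b + 1) / c * prsum Y) * expR (- (3 / 4) * ln (prsum Y)).
Proof.
have /andP[c1 c2] := @ln2_bounds R; have c0 : 0 < c by lra.
have [b1 cb] := @lnln2_bounds R.
(* Chosen so that [u.+2 <= K * X^(1/20)]: the five powers of [u] in the window term then cost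
   [X^(1/4)] and turn [1 / X] into [X^(-3/4)]. *)
have [K KE] : exists K : R, K = 14 * 20 by exists (14 * 20).
have K0 : 0 < K by rewrite KE mulr_gt0.
pose C : R := 2 + 171 * expR 1 + 4 * expR 2 * K ^+ 5.
have C0 : 0 < C by rewrite addr_gt0 ?addr_gt0 ?mulr_gt0 ?expR_gt0 ?exprn_gt0.
exists C => // Y B g X1 B1 g1 g2.
have B0 : 0 <= B by lra.
have X0 : 0 < prsum Y :> R by lra.
(* As [c + b >= 1/7] and [- b >= 1/4], the slack [14 * ln X] makes every decaying exponential in [u]
   at most [X^(-2)], enough even after summing over about [X] crossing times. *)
pose L := ln (@prsum R Y); pose u := (Num.truncn (14 * L)).+1.
have := sum_squarefree_bound u X0 B1 g1 g2; set X := prsum Y in X0 X1 L u *.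
have L0 : 0 <= L by rewrite ln_ge0.
have XE : X = expR L by rewrite lnK.
have uL : 14 * L < u%:R by exact: truncnS_gt.
have uL' : u%:R <= 14 * L + 1 by rewrite /u -natr1 lerD2r truncn_le mulr_ge0.
move=> /le_trans; apply.
have -> : (c + b) * (X / c) + X / c = (c + b + 1) / c * X by field; rewrite gt_eqF.
set M := expR _; rewrite [leRHS](_ : _ = M * (C * B * expR (- (3 / 4) * L))); last by ring.
rewrite ler_wpM2l ?expR_ge0 //.
set e := expR (- (3 / 4) * L).
have e1 : expR (- (c + b) * u%:R) <= B * e.
  apply: le_trans (ler_peMl (expR_ge0 _) B1); rewrite ler_expR.
  have := ler_wpM2r (_ : 0 <= u%:R) cb => /(_ (ler0n _ _)); lra.
have e2 : expR (b * u%:R) <= expR (- 2 * L).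
  rewrite ler_expR; have := ler_wpM2r (_ : 0 <= u%:R) b1 => /(_ (ler0n _ _)); lra.
have e3 : expR (- 2 * L) <= e by rewrite ler_expR; lra.
have e4 : B * expR (b * u%:R) <= B * e by rewrite ler_wpM2l // (le_trans e2).
have e5 : (Num.truncn X).+2%:R * (57 * expR 1) * expR (b * u%:R) <= 171 * expR 1 * (B * e).
  have h : (Num.truncn X).+2%:R <= 3 * X.
    have : (Num.truncn X)%:R <= X by rewrite truncn_le ltW.
    rewrite (natr2 (Num.truncn X)) => h; apply: le_trans (_ : X + 2 <= _); [by rewrite lerD2r|lra].
  apply: le_trans (_ : 3 * X * (57 * expR 1) * expR (- 2 * L) <= _).
    by rewrite ler_pM ?mulr_ge0 ?expR_ge0 // ler_wpM2r ?mulr_ge0 ?expR_ge0.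
  rewrite [leLHS](_ : _ = 171 * expR 1 * (X * expR (- 2 * L))); last by ring.
  rewrite ler_wpM2l ?mulr_ge0 ?expR_ge0 // XE -expRD.
  by apply: le_trans (ler_peMl (expR_ge0 _) B1); rewrite ler_expR; lra.
have e6 : 2 * u.+1%:R * B * (2 * u.+1%:R / X * (expR 2 * u.+2%:R ^+ 3)) <=
   4 * expR 2 * K ^+ 5 * (B * e).
  have u2 : u.+2%:R <= K * expR (L / 20).
    rewrite KE (natr2 u); have := expR_ge1Dx (L / 20); lra.
  have u1 : u.+1%:R <= u.+2%:R :> R by rewrite ler_nat.
  have -> : e = expR (L / 20) ^+ 5 / X.
    by rewrite XE -expRN -expRM_natl -expRD; congr expR; field.
  rewrite [leLHS](_ : _ = 4 * expR 2 * B / X * (u.+1%:R * u.+1%:R * u.+2%:R ^+ 3)); last by ring.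
  rewrite [leRHS](_ : _ = 4 * expR 2 * B / X * (K * expR (L / 20)) ^+ 5); last by rewrite exprMn; ring.
  rewrite ler_wpM2l ?mulr_ge0 ?expR_ge0 ?invr_ge0 ?(ltW X0) //.
  apply: le_trans (_ : u.+2%:R ^+ 5 <= _); last by rewrite lerXn2r ?nnegrE ?mulr_ge0 ?expR_ge0 ?(ltW K0).
  by rewrite -[5%N]/(2 + 3)%N exprD expr2 ler_wpM2r ?exprn_ge0 // ler_pM.
apply: le_trans (lerD (lerD (lerD e1 e4) e5) e6) _.
by rewrite le_eqVlt /C; apply/orP; left; apply/eqP; ring.
Qed.

End SumExists.


(** * Pairs of prime powers under a hyperbola *)

Section MangoldtBox.
Context {R : realType}.

Notation L := (@mangoldt R).

Lemma sum_mangoldt_sqrt_le y (P : pred nat) (E : R) : 0 <= E ->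
  (forall e, (0 < e)%N -> P e -> e%:R <= E) ->
  \sum_(1 <= e < y.+1 | P e) L e / Num.sqrt e%:R <= 8 * Num.sqrt E.
Proof.
move=> E0 PE; set N := Num.truncn E.
have NE : N%:R <= E by rewrite truncn_le.
apply: le_trans (_ : 8 * Num.sqrt N%:R <= _); last by rewrite ler_pM2l // ler_wsqrtr.
apply: le_trans (sum_mangoldt_sqrt N).
have F0 e : 0 <= L e / Num.sqrt e%:R by rewrite divr_ge0 ?mangoldt_ge0.
apply: le_trans (_ : \sum_(1 <= e < (maxn y N).+1 | P e) L e / Num.sqrt e%:R <= _).
  by rewrite [leRHS](big_cat_nat (n := y.+1)) //= ?lerDl ?sumr_ge0 // ltnS leq_maxl.
rewrite [leLHS](big_cat_nat (n := N.+1)) //=; last by rewrite ltnS leq_maxr.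
rewrite [X in _ + X]big1_seq ?addr0; last first.
  move=> e /andP[Pe]; rewrite mem_index_iota => /andP[Ne _].
  have e0 : (0 < e)%N by lia.
  have := truncn_ge_nat e E0; rewrite -/N (PE e e0 Pe) => h.
  by move: Ne; rewrite ltnNge h.
by rewrite big_mkcond /=; apply: ler_sum => e _; case: ifP.
Qed.

(** Difference of the two Mertens bounds: [N <= 2 * s * M] when [M > 0], and [4 + 1 + ln 2 <= 6];
    for [M = 0] one has [N <= s]. *)
Lemma sum_mangoldt_div_between y q s : (0 < q)%N -> (0 < s)%N ->
  \sum_(1 <= d < y.+1 | (y < d * (q * s))%N && (d * q <= y)%N) L d / d%:R <= ln s%:R + 6.
Proof.
move=> q0 s0; set N := (y %/ q)%N; set M := (y %/ (q * s))%N.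
have ls0 : 0 <= ln s%:R :> R by exact: lnn_ge0.
have F0 d : 0 <= L d / d%:R by rewrite divr_ge0 ?mangoldt_ge0.
have NY : (N <= y)%N by rewrite leq_div.
have MN : (M <= N)%N by rewrite /M /N divnMA leq_div.
have E : \sum_(1 <= d < y.+1 | (y < d * (q * s))%N && (d * q <= y)%N) L d / d%:R <=
         \sum_(M.+1 <= d < N.+1) L d / d%:R.
  rewrite (big_cat_nat (n := N.+1)) //= [X in _ + X]big1_seq ?addr0; last first.
    move=> d /andP[/andP[_ dq]]; rewrite mem_index_iota => /andP[Nd _].
    by move: dq; rewrite -leq_divRL // leqNgt Nd.
  rewrite (big_cat_nat (n := M.+1)) //= [X in X + _]big1_seq ?add0r; last first.
    move=> d /andP[/andP[yd _]]; rewrite mem_index_iota => /andP[_ dM].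
    by move: yd; rewrite -ltn_divLR ?muln_gt0 ?q0 //; rewrite -/M => yd; lia.
  by rewrite big_mkcond /=; apply: ler_sum => e _; case: ifP.
apply: le_trans E _.
have [N0|N0] := posnP N.
  by rewrite N0 big_geq //; lra.
have [M0|M0] := posnP M.
  rewrite M0; apply: le_trans (sum_mangoldt_div_le N0) _.
  have Ns : (N <= s)%N.
    move: M0; rewrite /M divnMA -/N => /eqP; rewrite -leqn0 leqNgt divn_gt0 // -ltnNge.
    exact: ltnW.
  have : ln N%:R <= ln s%:R :> R by rewrite ler_ln ?posrE ?ltr0n ?ler_nat.
  lra.
have := sum_mangoldt_div_le N0 => /(_ R); rewrite (big_cat_nat (n := M.+1)) //=.
have := @sum_mangoldt_div_ge R M M0.
have : ln N%:R <= ln s%:R + (ln 2 + ln M%:R) :> R.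
  rewrite -!lnM ?posrE ?ltr0n ?mulr_gt0 ?ltr0n // ler_ln ?posrE ?mulr_gt0 ?ltr0n //.
  rewrite -!natrM ler_nat mulnC; have := ltn_ceil N s0; rewrite -divnMA -/M.
  by move=> h; apply: leq_trans (ltnW h) _; rewrite leq_mul2r; lia.
have /andP[_ l2] := @ln2_bounds R.
set x := \sum_(1 <= d < M.+1) _; set z := \sum_(M.+1 <= d < N.+1) _.
lra.
Qed.

(** With [Q = y / sqrt (r1 * r2 * s)]: for [d <= y / (r1 * s)] the condition [e * r2 <= y] is used,
    and two sums of square root size give [64 * Q]; for larger [d] the product condition leaves
    [8 * Q * L d / d], which sums to [8 * Q * (ln s + 6)]. Hence [112 = 64 + 48]. *)
Lemma mangoldt_box y r1 r2 s : (0 < r1)%N -> (0 < r2)%N -> (0 < s)%N ->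
  \sum_(1 <= d < y.+1) \sum_(1 <= e < y.+1 |
     [&& (d * r1 <= y)%N, (e * r2 <= y)%N & (d * e * (r1 * r2 * s) <= y ^ 2)%N])
     (L d / Num.sqrt d%:R) * (L e / Num.sqrt e%:R) <=
  112 * (y%:R / Num.sqrt (r1 * r2 * s)%:R) * (1 + ln s%:R).
Proof.
move=> r10 r20 s0; set m := (r1 * r2 * s)%N.
have m0 : (0 < m)%N by rewrite !muln_gt0 r10 r20.
have R1 : 0 < r1%:R :> R by rewrite ltr0n.
have R2 : 0 < r2%:R :> R by rewrite ltr0n.
have S0 : 0 < s%:R :> R by rewrite ltr0n.
have M0 : 0 < m%:R :> R by rewrite ltr0n.
have sM0 : 0 < Num.sqrt m%:R :> R by rewrite sqrtr_gt0.
have F0 d : 0 <= L d / Num.sqrt d%:R by rewrite divr_ge0 ?mangoldt_ge0.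
have ls0 : 0 <= ln s%:R :> R by exact: lnn_ge0.
set Q := y%:R / Num.sqrt m%:R.
have Q0 : 0 <= Q by rewrite divr_ge0.
apply: le_trans (_ : \sum_(1 <= d < y.+1) ((if (d * (r1 * s) <= y)%N then
     8 * Num.sqrt (y%:R / r2%:R) * (L d / Num.sqrt d%:R) else 0) +
     8 * Q * (if (y < d * (r1 * s))%N && (d * r1 <= y)%N then L d / d%:R else 0)) <= _).
  apply: ler_sum_nat => d /andP[d0 _]; rewrite -mulr_sumr.
  have D0 : 0 < d%:R :> R by rewrite ltr0n.
  have [dle|dgt] := leqP (d * (r1 * s)) y.
    rewrite mulr0 addr0 mulrC ler_wpM2r //.
    apply: sum_mangoldt_sqrt_le => [|e e0 /and3P[_ h _]]; first by rewrite divr_ge0.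
    by rewrite ler_pdivlMr // -natrM ler_nat.
  rewrite add0r; case: (boolP (d * r1 <= y)%N) => dr; last first.
    by rewrite big1 ?mulr0 // => e; rewrite (negbTE dr).
  apply: le_trans (_ : L d / Num.sqrt d%:R * (8 * Num.sqrt (y%:R ^+ 2 / (d%:R * m%:R))) <= _).
    rewrite ler_wpM2l //; apply: sum_mangoldt_sqrt_le => [|e e0 /and3P[_ _ h]].
      by rewrite divr_ge0 ?mulr_ge0.
    by rewrite ler_pdivlMr ?mulr_gt0 // -natrX -!natrM ler_nat mulnA [(e * d)%N]mulnC.
  rewrite le_eqVlt; apply/orP; left; apply/eqP.
  rewrite sqrtrM ?exprn_ge0 // sqrtr_sqr ger0_norm // sqrtrV ?mulr_ge0 //.
  rewrite sqrtrM // /Q -[in RHS](@sqr_sqrtr R d%:R) //.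
  by rewrite /=; field; rewrite !gt_eqF // sqrtr_gt0.
rewrite big_split /= -mulr_sumr -!big_mkcond /= -mulr_sumr.
have h2 := @sum_mangoldt_div_between y r1 s r10 s0.
have h1 : \sum_(1 <= d < y.+1 | (d * (r1 * s) <= y)%N) L d / Num.sqrt d%:R <=
   8 * Num.sqrt (y%:R / (r1%:R * s%:R)).
  apply: sum_mangoldt_sqrt_le => [|d d0 h]; first by rewrite divr_ge0 ?mulr_ge0.
  by rewrite ler_pdivlMr ?mulr_gt0 // -!natrM ler_nat.
have E : Num.sqrt (y%:R / r2%:R) * Num.sqrt (y%:R / (r1%:R * s%:R)) = Q.
  rewrite -sqrtrM ?divr_ge0 // (_ : _ / _ * _ = y%:R ^+ 2 / m%:R); last first.
    by rewrite /m !natrM; field; rewrite !gt_eqF.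
  by rewrite sqrtrM ?exprn_ge0 // sqrtr_sqr ger0_norm // sqrtrV.
have h1' := ler_wpM2l (_ : 0 <= 8 * Num.sqrt (y%:R / r2%:R)) h1.
have {}h1' := h1' ltac:(by rewrite mulr_ge0 ?sqrtr_ge0).
have h2' := ler_wpM2l (_ : 0 <= 8 * Q) h2.
have {}h2' := h2' ltac:(by rewrite mulr_ge0).
apply: le_trans (lerD h1' h2') _.
rewrite [X in X + _](_ : _ = 64 * Q); last by rewrite -E; ring.
have := mulr_ge0 Q0 ls0; lra.
Qed.

End MangoldtBox.


(** * Divisors and the cluster bound *)

Lemma size_divisors_mul_prime p r : prime p -> (0 < r)%N ->
  (size (divisors (p * r)) <= 2 * size (divisors r))%N.
Proof.
move=> pp r0; have pr0 : (0 < p * r)%N by rewrite muln_gt0 prime_gt0.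
rewrite mul2n -addnn -[X in (_ <= X + _)%N](size_map (muln p)) -size_cat.
apply: uniq_leq_size; first exact: divisors_uniq.
move=> d; rewrite -dvdn_divisors // => dpr; rewrite mem_cat.
have [pd|pd] := boolP (p %| d)%N.
  have [k E] := dvdnP pd; move: dpr; rewrite E mulnC dvdn_pmul2l ?prime_gt0 // => kr.
  by rewrite map_f // -dvdn_divisors.
rewrite (@Gauss_dvdr d p r) in dpr; last by rewrite coprime_sym prime_coprime.
by rewrite orbC -dvdn_divisors // dpr.
Qed.

Lemma size_divisors_prodl n I : I \in subs (plist n) ->
  forall a : pred nat, (size (divisors (\prod_(p <- I | a p) p)) <= 2 ^ count a I)%N.
Proof.
move=> In a; have : all prime I by apply/allP => p /(subs_plist_prime In) /andP[].
elim: I {In} => [|p I IH] /=; first by rewrite big_nil.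
move=> /andP[pp Ip]; rewrite big_cons; case: ifP => ap; last exact: IH.
apply: leq_trans (size_divisors_mul_prime pp _) _.
  by rewrite big_seq_cond prodn_cond_gt0 // => q /andP[/(allP Ip) /prime_gt0].
by rewrite add1n expnS leq_mul2l /= IH.
Qed.

(* [m d e] is a product [(d a) (e (m / a))] of two integers at most [y]. *)
Definition splits (y m d e : nat) : bool :=
  has (fun a => [&& (a %| m)%N, (d * a <= y)%N & (e * (m %/ a) <= y)%N]) (divisors m).

Lemma ln_prodn {R : realType} (I : seq nat) (a : pred nat) : all (fun p => 0 < p)%N I ->
  ln (\prod_(p <- I | a p) p)%N%:R = \sum_(p <- I | a p) ln p%:R :> R.
Proof.
elim: I => [|p I IH] /=; first by rewrite !big_nil ln1.
move=> /andP[p0 Ip]; rewrite !big_cons -(IH Ip); case: ifP => // _.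
rewrite natrM lnM // posrE ltr0n // big_seq_cond.
by apply: prodn_cond_gt0 => q /andP[/(allP Ip)].
Qed.

Section DivisorRegion.
Context {R : realType}.

Notation L := (@mangoldt R).

(** Up to a constant and the factor [y / sqrt m] this plays the role of G(m): the weight of the
    prime powers [d], [e] that complete [m] to an entry of the table. *)
Definition region_sum (y m : nat) : R :=
  \sum_(1 <= d < y.+1) \sum_(1 <= e < y.+1 | splits y m d e)
     (L d / Num.sqrt d%:R) * (L e / Num.sqrt e%:R).

Let F0 d : 0 <= L d / Num.sqrt d%:R.
Proof. by rewrite divr_ge0 ?mangoldt_ge0. Qed.

Lemma region_sum_ge0 y m : 0 <= region_sum y m.
Proof. by apply: sumr_ge0 => d _; apply: sumr_ge0 => e _; rewrite mulr_ge0. Qed.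

(* The divisors of [r s] lie in at most tau(r) clusters, each of length [ln s] on
   the logarithmic scale. *)
Lemma region_sum_le y r s : (0 < r)%N -> (0 < s)%N ->
  region_sum y (r * s) <=
  112 * (y%:R / Num.sqrt (r * s)%:R) * (size (divisors r))%:R * (1 + ln s%:R).
Proof.
move=> r0 s0; set m := (r * s)%N; have m0 : (0 < m)%N by rewrite muln_gt0 r0.
apply: le_trans (_ : \sum_(t <- divisors r) \sum_(1 <= d < y.+1) \sum_(1 <= e < y.+1 |
     [&& (d * t <= y)%N, (e * (r %/ t) <= y)%N & (d * e * (t * (r %/ t) * s) <= y ^ 2)%N])
     (L d / Num.sqrt d%:R) * (L e / Num.sqrt e%:R) <= _); last first.
  apply: le_trans (_ : \sum_(t <- divisors r) 112 * (y%:R / Num.sqrt m%:R) * (1 + ln s%:R) <= _).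
    rewrite big_seq [leRHS]big_seq; apply: ler_sum => t; rewrite -dvdn_divisors // => tr.
    have t0 : (0 < t)%N by apply: dvdn_gt0 tr.
    have rt0 : (0 < r %/ t)%N by rewrite divn_gt0 // dvdn_leq.
    have E : (t * (r %/ t) * s = m)%N by rewrite mulnC [(t * _)%N]mulnC divnK // mulnC.
    by have := @mangoldt_box R y t (r %/ t) s t0 rt0 s0; rewrite E.
  rewrite big_const_seq count_predT iter_addr_0 -[leLHS]mulr_natr le_eqVlt; apply/orP; left; apply/eqP.
  by ring.
rewrite [leRHS]exchange_big /=; apply: ler_sum_nat => d /andP[d0 _].
under [leRHS]eq_bigr do rewrite big_mkcond /=.
rewrite exchange_big /= big_mkcond /=; apply: ler_sum_nat => e /andP[e0 _].
have S0 (P : pred nat) : 0 <= \sum_(t <- divisors r)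
    (if P t then L d / Num.sqrt d%:R * (L e / Num.sqrt e%:R) else 0).
  by apply: sumr_ge0 => t _; case: ifP => // _; rewrite mulr_ge0.
case: ifP => // /hasP[a _ /and3P[am da ea]].
have a0 : (0 < a)%N by apply: dvdn_gt0 am.
(* The divisor [a] is assigned to its gcd with [r]: then [t <= a], and [r / t], being coprime to
   [a / t], divides [m / a]; so the box of [t] contains [(d, e)]. *)
set t := gcdn r a.
have tr : (t %| r)%N by exact: dvdn_gcdl.
have t0 : (0 < t)%N by rewrite gcdn_gt0 r0.
have ta : (t <= a)%N by rewrite dvdn_leq // dvdn_gcdr.
have rta : (r %/ t <= m %/ a)%N.
  apply: dvdn_leq; first by rewrite divn_gt0 // dvdn_leq.
  have co : coprime (r %/ t) (a %/ t).
    rewrite /coprime; apply/eqP; apply/eqP; rewrite -(eqn_pmul2r t0) mul1n.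
    by rewrite muln_gcdl !divnK ?dvdn_gcdr.
  rewrite -(Gauss_dvdr _ co) -(dvdn_pmul2l t0) mulnA [(t * (a %/ t))%N]mulnC.
  rewrite divnK ?dvdn_gcdr // [(t * _)%N]mulnC divnK // [(a * _)%N]mulnC divnK //.
  by rewrite dvdn_mulr.
have Et : (t * (r %/ t) * s = m)%N by rewrite mulnC [(t * _)%N]mulnC divnK // mulnC.
rewrite (big_rem t) -?dvdn_divisors //=.
rewrite ifT ?lerDl; last first.
  rewrite Et; apply/and3P; split.
  - by apply: leq_trans da; rewrite leq_mul2l ta orbT.
  - by apply: leq_trans ea; rewrite leq_mul2l rta orbT.
  - have -> : m = (a * (m %/ a))%N by rewrite mulnC divnK.
    rewrite mulnACA expnS expn1; exact: leq_mul.
by apply: sumr_ge0 => t' _; case: ifP => // _; rewrite mulr_ge0.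
Qed.

Lemma region_sum_eq0 y m : (y ^ 2 < m)%N -> region_sum y m = 0.
Proof.
move=> ym; rewrite /region_sum big1_seq // => d /andP[_]; rewrite mem_index_iota => /andP[d0 _].
rewrite big1_seq // => e /andP[/hasP[a _ /and3P[am da ea]]]; rewrite mem_index_iota => /andP[e0 _].
have : (d * a * (e * (m %/ a)) <= y ^ 2)%N by rewrite expnS expn1 leq_mul.
rewrite mulnACA [(a * _)%N]mulnC divnK // => h.
by move: ym; rewrite ltnNge (leq_trans _ h) // leq_pmull // muln_gt0 d0.
Qed.

Notation c := (@ln R 2).
Notation b := (@ln R (@ln R 2)).

Lemma sum_region_sum : exists2 C : R, 0 < C & forall y : nat, (0 < y)%N ->
  1 <= prsum (y ^ 2) :> R ->
  \sum_(1 <= m < (y ^ 2).+1) region_sum y m / Num.sqrt m%:R <=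
    C * y%:R * (expR ((c + b + 1) / c * prsum (y ^ 2)) * expR (- (3 / 4) * ln (prsum (y ^ 2)))).
Proof.
have [C C0 HC] := @sum_squarefree_bound_exp R.
have [K KE] : exists K : R, K = 112 by exists 112.
have K0 : 0 < K by rewrite KE.
exists (K * 12 * 25 * C); first by rewrite !mulr_gt0.
move=> y y0 X1; set Y := (y ^ 2)%N in X1 *.
have Y0 : (0 < Y)%N by rewrite expn_gt0 y0.
have Ry : 0 < y%:R :> R by rewrite ltr0n.
apply: le_trans (sum_square_decomp_le (f := fun m => region_sum y m / Num.sqrt m%:R) Y _) _.
  by move=> m; rewrite divr_ge0 ?region_sum_ge0.
set D := expR _ * expR _.
apply: le_trans (_ : \sum_(1 <= w < Y.+1) ((1 + 2 * ln w%:R) / (w ^ 2)%:R) * (K * y%:R * (25 * C * D)) <= _); last first.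
  rewrite -mulr_suml [leRHS](_ : _ = 12 * (K * y%:R * (25 * C * D))); last by ring.
  by rewrite ler_wpM2r ?sum_ln_div_sqr // !mulr_ge0 ?expR_ge0 // ltW.
apply: ler_sum_nat => w /andP[w0 _].
have lw : 0 <= ln w%:R :> R by exact: lnn_ge0.
have W0 : 0 < w%:R :> R by rewrite ltr0n.
have lw1 : 1 <= 1 + 2 * ln w%:R :> R by lra.
(* Normalized so that the cluster bound holds without constants: [K] is the 112 of [region_sum_le],
   and [1 + 2 * ln w] pays for moving [w^2] into [s]. *)
pose g (I : seq nat) : R := region_sum y (w ^ 2 * prodl I) * Num.sqrt (w ^ 2 * prodl I)%:R /
   (K * y%:R * (1 + 2 * ln w%:R)).
have w20 : (0 < w ^ 2)%N by rewrite expn_gt0 w0.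
have lwn0 : 1 + 2 * ln w%:R != 0 :> R by rewrite gt_eqF //; lra.
have den0 : 0 < K * y%:R * (1 + 2 * ln w%:R) by rewrite !mulr_gt0 //; lra.
have g_le I r s : (r * s)%N = (w ^ 2 * prodl I)%N -> (0 < r)%N -> (0 < s)%N ->
    g I * (1 + 2 * ln w%:R) <= (size (divisors r))%:R * (1 + ln s%:R).
  move=> E r0 s0; have := region_sum_le y r0 s0; rewrite /g -E -KE.
  have S0 : 0 < Num.sqrt (r * s)%:R :> R by rewrite sqrtr_gt0 ltr0n muln_gt0 r0.
  move=> /(ler_wpM2r (ltW S0)) h.
  rewrite -[leRHS](@mulfK _ (K * y%:R)) ?gt_eqF ?mulr_gt0 //.
  rewrite invfM mulrA mulfVK //.
  rewrite ler_pM2r ?invr_gt0 ?mulr_gt0 //; apply: le_trans h _.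
  by rewrite le_eqVlt; apply/orP; left; apply/eqP; field; rewrite gt_eqF.
have G1 I T : I \in subs (plist Y) -> (T <= Y)%N -> g I <=
    (2 ^ count (fun p => T < p)%N I)%:R * (1 + \sum_(p <- I | (p <= T)%N) ln p%:R).
  move=> In TY; have Ipos := prodl_gt0 In.
  set r := (\prod_(p <- I | (T < p)%N) p)%N; set s0 := (\prod_(p <- I | (p <= T)%N) p)%N.
  have E0 : prodl I = (r * s0)%N.
    rewrite /prodl (bigID (fun p => T < p)%N) /=; congr (_ * _)%N.
    by apply: eq_bigl => p; rewrite -leqNgt.
  have rs : (0 < r * s0)%N by rewrite -E0.
  have [r0 sp] : (0 < r)%N /\ (0 < s0)%N by apply/andP; rewrite -muln_gt0.
  have l0 : 0 <= ln s0%:R :> R by exact: lnn_ge0.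
  have h := @g_le I r (w ^ 2 * s0)%N ltac:(by rewrite E0 mulnCA) r0 ltac:(by rewrite muln_gt0 w20).
  have lE : ln s0%:R = \sum_(p <- I | (p <= T)%N) ln p%:R :> R.
    by apply: ln_prodn; apply/allP => p /(subs_plist_prime In) /andP[/prime_gt0].
  have s1 : 1 + ln (w ^ 2 * s0)%:R <= (1 + 2 * ln w%:R) * (1 + ln s0%:R) :> R.
    rewrite natrM natrX lnM ?posrE ?exprn_gt0 ?ltr0n // lnXn //.
    rewrite -[ln w%:R *+ 2]mulr_natl; have := mulr_ge0 lw l0; lra.
  have dv : (size (divisors r))%:R <= (2 ^ count (fun p => T < p)%N I)%:R :> R.
    by rewrite ler_nat (size_divisors_prodl In).
  rewrite -lE -(ler_pM2r (_ : 0 < 1 + 2 * ln w%:R)); last lra.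
  apply: le_trans h _; apply: le_trans (ler_wpM2l (ler0n _ _) s1) _.
  rewrite [leRHS](_ : _ = (2 ^ count (fun p => T < p)%N I)%:R * ((1 + 2 * ln w%:R) * (1 + ln s0%:R))); last by ring.
  by rewrite ler_wpM2r // mulr_ge0 //; lra.
(* The trivial split [r = 1], [s = m]: [1 + ln Y <= 25 * expR (prsum Y)]. For [m > y^2] the region
   is empty. *)
have G2 I : I \in subs (plist Y) -> g I <= 25 * expR (prsum Y).
  move=> In; have Ipos := prodl_gt0 In.
  have m0 : (0 < w ^ 2 * prodl I)%N by rewrite muln_gt0 w20.
  have e1 : 1 <= expR (prsum Y) :> R by rewrite -expR0 ler_expR prsum_ge0.
  have [big|small] := ltnP Y (w ^ 2 * prodl I)%N.
    by rewrite /g region_sum_eq0 // !mul0r mulr_ge0 ?expR_ge0.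
  have := @g_le I 1%N (w ^ 2 * prodl I)%N ltac:(by rewrite mul1n) isT m0.
  rewrite /= mul1r => h.
  have g0 : 0 <= g I by rewrite /g divr_ge0 ?(ltW den0) // mulr_ge0 ?region_sum_ge0 ?sqrtr_ge0.
  apply: le_trans (ler_peMr g0 lw1) _; apply: le_trans h _.
  have : ln (w ^ 2 * prodl I)%:R <= ln Y%:R :> R by rewrite ler_ln ?posrE ?ltr0n ?ler_nat.
  have := @ln_le_expR_prsum R Y; lra.
have := HC Y 25 g X1 ltac:(lra) G1 G2.
rewrite [X in _ <= X -> _](_ : _ = 25 * C * D); last by rewrite /D; ring.
move=> h.
have f0 : 0 <= (1 + 2 * ln w%:R) / (w ^ 2)%:R * (K * y%:R) :> R.
  apply: mulr_ge0; first by rewrite divr_ge0 //; lra.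
  by rewrite mulr_ge0 ?(ltW K0) ?(ltW Ry).
rewrite mulrA; apply: le_trans (ler_wpM2l f0 h).
rewrite mulr_sumr big_seq [leRHS]big_seq; apply: ler_sum => I In.
have Ipos := prodl_gt0 In.
rewrite le_eqVlt; apply/orP; left; apply/eqP; rewrite /g.
have P0 : 0 < (prodl I)%:R :> R by rewrite ltr0n.
have Q0 : 0 < (w ^ 2)%:R :> R by rewrite ltr0n.
have S0 : 0 < (w ^ 2 * prodl I)%:R :> R by rewrite natrM mulr_gt0.
have sS : 0 < Num.sqrt (w ^ 2 * prodl I)%:R :> R by rewrite sqrtr_gt0.
have E : (w ^ 2)%:R * (prodl I)%:R = Num.sqrt (w ^ 2 * prodl I)%:R ^+ 2 :> R.
  by rewrite sqr_sqrtr ?ltW // natrM.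
set rs := region_sum _ _; set S := Num.sqrt _ in sS E *.
transitivity (rs * S / ((w ^ 2)%:R * (prodl I)%:R)); last first.
  by field; rewrite !gt_eqF //; lra.
by rewrite E; field; rewrite gt_eqF.
Qed.

End DivisorRegion.


(** * The multiplication table *)

Definition mtab (y : nat) : seq nat := undup [seq (a * b)%N | a <- iota 1 y, b <- iota 1 y].

Lemma mem_mtab y n : reflect (exists a b, [/\ (0 < a <= y)%N, (0 < b <= y)%N & n = (a * b)%N])
  (n \in mtab y).
Proof.
rewrite mem_undup; apply: (iffP idP).
  move=> /allpairsP[[a e]] /= [ha he ->]; exists a, e.
  by move: ha he; rewrite !mem_iota => ? ?; split => //; lia.
move=> [a [e [ha he ->]]]; apply/allpairsP; exists (a, e).
by rewrite /= !mem_iota; split => //; lia.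
Qed.

Lemma sum_undup_le {R : realType} (s : seq nat) (F : nat -> R) : (forall n, 0 <= F n) ->
  \sum_(n <- undup s) F n <= \sum_(n <- s) F n.
Proof.
move=> F0; elim: s => [|n s IH] /=; first by rewrite !big_nil.
rewrite big_cons; case: ifP => _; first by rewrite (le_trans IH) // lerDr.
by rewrite big_cons lerD2l.
Qed.

Definition bigfactor (y a n : nat) : bool :=
  [&& (a %| n)%N, (y < a ^ 2)%N, (n %/ a <= y)%N & (y < (n %/ a) ^ 2)%N].

Definition balanced (y n : nat) : bool := has (bigfactor y ^~ n) (iota 1 y).

Section MultiplicationTable.
Context {R : realType}.

Notation L := (@mangoldt R).
Notation c := (@ln R 2).
Notation b := (@ln R (@ln R 2)).

Lemma sum_inv_sqrt N : \sum_(1 <= a < N.+1) (Num.sqrt a%:R)^-1 <= 2 * Num.sqrt N%:R :> R.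
Proof.
elim: N => [|N IH]; first by rewrite big_geq // sqrtr0 mulr0.
rewrite big_nat_recr //=; apply: le_trans (lerD IH (lexx _)) _.
set s := Num.sqrt N%:R; set t := Num.sqrt N.+1%:R.
have t0 : 0 < t by rewrite sqrtr_gt0 ltr0n.
have s0 : 0 <= s by exact: sqrtr_ge0.
have st : s <= t by rewrite ler_wsqrtr // ler_nat.
have E : t * t = s * s + 1 by rewrite -!expr2 !sqr_sqrtr // natr1.
have : t^-1 <= 2 * t - 2 * s; last by lra.
rewrite -[leLHS]div1r ler_pdivrMr //.
by have := sqr_ge0 (t - s); rewrite expr2; nra.
Qed.

Lemma sum_inv_sqrt_small y :
  \sum_(1 <= a < y.+1 | (a ^ 2 <= y)%N) (Num.sqrt a%:R)^-1 <= 2 * Num.sqrt (Num.sqrt y%:R) :> R.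
Proof.
set A := Num.truncn (@Num.sqrt R y%:R).
have Ay : A%:R <= @Num.sqrt R y%:R by rewrite truncn_le sqrtr_ge0.
apply: le_trans (_ : 2 * Num.sqrt A%:R <= _); last by rewrite ler_pM2l // ler_wsqrtr.
apply: le_trans (sum_inv_sqrt A).
have aA a : (a ^ 2 <= y)%N -> (a <= A)%N.
  move=> h; rewrite truncn_ge_nat ?sqrtr_ge0 // -[a%:R]ger0_norm // -sqrtr_sqr ler_wsqrtr //.
  by rewrite -natrX ler_nat.
have Ay' : (A <= y)%N.
  have : A%:R ^+ 2 <= @Num.sqrt R y%:R ^+ 2 by rewrite lerXn2r // ?nnegrE ?sqrtr_ge0.
  by rewrite sqr_sqrtr // -natrX ler_nat; nia.
rewrite (big_cat_nat (n := A.+1)) //= [X in _ + X]big1_seq ?addr0; last first.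
  by move=> a /andP[/aA h]; rewrite mem_index_iota => /andP[Aa _]; move: h; rewrite leqNgt Aa.
by rewrite big_mkcond /=; apply: ler_sum => a _; case: ifP => // _; rewrite invr_ge0 sqrtr_ge0.
Qed.

(** One factor is at most [sqrt y], so over all pairs the sum is at most
    [2 (2 y^(1/4)) (2 y^(1/2))], smaller than the main term by a power of [y]. *)
Lemma sum_mtab_unbalanced y :
  \sum_(n <- mtab y | ~~ balanced y n) (Num.sqrt n%:R)^-1 <=
  8 * (Num.sqrt (Num.sqrt y%:R) * Num.sqrt y%:R) :> R.
Proof.
rewrite big_mkcond /=.
have i0 (n : nat) : 0 <= (Num.sqrt n%:R)^-1 :> R by rewrite invr_ge0 sqrtr_ge0.
apply: le_trans (sum_undup_le _ _) _; first by move=> n; case: ifP.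
rewrite big_allpairs_dep /=.
pose x (n : nat) : R := (Num.sqrt n%:R)^-1.
pose P (n : nat) : R := (n ^ 2 <= y)%N%:R.
set SP := \sum_(1 <= n < y.+1 | (n ^ 2 <= y)%N) (Num.sqrt n%:R)^-1 : R.
set ST := \sum_(1 <= n < y.+1) (Num.sqrt n%:R)^-1 : R.
have SPE : \sum_(n <- iota 1 y) P n * x n = SP.
  rewrite /SP [RHS]big_mkcond /= /index_iota subn1; apply: eq_bigr => n _; rewrite /P.
  by case: ifP => _; rewrite ?mul1r ?mul0r.
have STE : \sum_(n <- iota 1 y) x n = ST by rewrite /ST /index_iota subn1.
apply: le_trans (_ : 2 * (SP * ST) <= _); last first.
  have h := ler_pM (sumr_ge0 _ _) (sumr_ge0 _ _) (@sum_inv_sqrt_small y) (@sum_inv_sqrt y).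
  have := h (fun n _ => i0 n) (fun n _ => i0 n); rewrite -/SP -/ST.
  set p := SP * ST; set q := Num.sqrt (Num.sqrt y%:R); set t := Num.sqrt _.
  by move=> hp; rewrite [leRHS](_ : _ = 2 * (2 * q * (2 * t))); [rewrite ler_pM2l|ring].
apply: le_trans (_ : \sum_(n <- iota 1 y) \sum_(m <- iota 1 y)
   (P n * x n * x m + x n * (P m * x m)) <= _); last first.
  under eq_bigr do rewrite big_split /=.
  by rewrite big_split /= -!big_distrlr /= SPE STE [ST * _]mulrC -mulr2n mulr_natl.
rewrite big_seq [leRHS]big_seq; apply: ler_sum => n; rewrite mem_iota => nY.
rewrite big_seq [leRHS]big_seq; apply: ler_sum => m; rewrite mem_iota => mY.
have x0 k : 0 <= x k by exact: i0.
have P0 k : 0 <= P k by exact: ler0n.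
case: ifP => [nb|_]; last by rewrite addr_ge0 ?mulr_ge0.
have -> : (Num.sqrt (n * m)%:R)^-1 = x n * x m by rewrite natrM sqrtrM // invfM.
have [h|h] := leqP (n ^ 2) y.
  have -> : P n = 1 by rewrite /P h.
  by rewrite mul1r lerDl !mulr_ge0.
have [h'|h'] := leqP (m ^ 2) y.
  have -> : P m = 1 by rewrite /P h'.
  by rewrite mul1r lerDr !mulr_ge0.
exfalso; move/negP: nb; apply; apply/hasP; exists n; first by rewrite mem_iota.
have n0 : (0 < n)%N by lia.
by rewrite /bigfactor dvdn_mulr // h mulKn // h'; lia.
Qed.

(* Both factors [a], [e] of a balanced [n = a e] have logarithm at least
   [ln y / 2]; expanding [ln a = sum_(d | a) mangoldt d], and likewise for [e],
   bounds [(ln y)^2 / 4] by the number of [(m, d, e)] counted here. *)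
Let T (y n : nat) : R := \sum_(1 <= m < (y ^ 2).+1) \sum_(1 <= d < y.+1)
  \sum_(1 <= e < y.+1 | splits y m d e)
    (m * d * e == n)%N%:R * (L d / Num.sqrt d%:R * (L e / Num.sqrt e%:R) / Num.sqrt m%:R).

Let term_ge0 d e m : 0 <= L d / Num.sqrt d%:R * (L e / Num.sqrt e%:R) / Num.sqrt m%:R.
Proof. by rewrite !mulr_ge0 ?mangoldt_ge0 ?invr_ge0 ?sqrtr_ge0. Qed.

(** A triple [(m, d, e)] determines [n = m * d * e], so it is counted at most once as [n] runs
    through the table. *)
Let sum_T y : \sum_(n <- mtab y) T y n <=
  \sum_(1 <= m < (y ^ 2).+1) region_sum y m / Num.sqrt m%:R.
Proof.
rewrite exchange_big /=; apply: ler_sum => m _; rewrite /region_sum mulr_suml.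
rewrite exchange_big /=; apply: ler_sum => d _; rewrite mulr_suml.
rewrite exchange_big /=; apply: ler_sum => e _.
rewrite -mulr_suml ler_piMl ?term_ge0 //.
have [h|h] := boolP ((m * d * e)%N \in mtab y).
  rewrite (bigD1_seq (m * d * e)%N) ?undup_uniq //= eqxx big1 ?addr0 // => i.
  by rewrite eq_sym => /negbTE ->.
rewrite big1_seq ?ler01 // => i /= iy; case: eqP => // E.
by rewrite -E (negbTE h) in iy.
Qed.

Let T_balanced y n : (0 < y)%N -> balanced y n ->
  (ln y%:R) ^+ 2 / 4 / Num.sqrt n%:R <= T y n.
Proof.
move=> y0 /hasP[a]; rewrite mem_iota => ay /and4P[an ya ny yn].
set e := (n %/ a)%N in ny yn.
have a0 : (0 < a)%N by lia.
have e0 : (0 < e)%N by case: e yn {ny} => //; rewrite exp0n.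
have nE : n = (a * e)%N by rewrite mulnC divnK.
have half z : (0 < z)%N -> (y < z ^ 2)%N -> ln y%:R / 2 <= ln z%:R :> R.
  move=> z0 yz; have : ln y%:R <= ln (z ^ 2)%:R :> R.
    by rewrite ler_ln ?posrE ?ltr0n ?expn_gt0 ?z0 // ler_nat ltnW.
  rewrite natrX lnXn ?ltr0n // -[X in _ <= X -> _]mulr_natl; lra.
have l0 : 0 <= ln y%:R / 2 :> R by rewrite divr_ge0 ?lnn_ge0.
have sE : Num.sqrt n%:R = Num.sqrt a%:R * Num.sqrt e%:R :> R by rewrite nE natrM sqrtrM.
have i0 z : 0 <= (Num.sqrt z%:R)^-1 :> R by rewrite invr_ge0 sqrtr_ge0.
apply: le_trans (_ : ln a%:R * ln e%:R / Num.sqrt n%:R <= _).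
  apply: ler_wpM2r => //; have := ler_pM l0 l0 (half _ a0 ya) (half _ e0 yn).
  by rewrite expr2; lra.
have aY : (0 < a < y.+1)%N by rewrite a0 ltnS; lia.
have eY : (0 < e < y.+1)%N by rewrite e0 ltnS.
rewrite -(sum_mangoldt aY) -(sum_mangoldt eY) big_distrlr /= /T.
rewrite [leRHS]exchange_big /= mulr_suml.
apply: ler_sum_nat => d /andP[d0 dy].
under [leRHS]eq_bigr do rewrite big_mkcond /=.
rewrite [leRHS]exchange_big /= mulr_suml; apply: ler_sum_nat => f /andP[f0 fy].
have G0 m : 0 <= (if splits y m d f then (m * d * f == n)%N%:R *
   (L d / Num.sqrt d%:R * (L f / Num.sqrt f%:R) / Num.sqrt m%:R) else 0).
  by case: ifP => // _; rewrite mulr_ge0 ?term_ge0.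
have [da|da] := boolP (d %| a)%N; last by rewrite !mul0r; apply: sumr_ge0 => m _.
have [fe|fe] := boolP (f %| e)%N; last by rewrite mul0r mulr0 mul0r; apply: sumr_ge0 => m _.
set a' := (a %/ d)%N; set e' := (e %/ f)%N.
have aE : (d * a' = a)%N by rewrite mulnC divnK.
have eE : (f * e' = e)%N by rewrite mulnC divnK.
have a'0 : (0 < a')%N by rewrite divn_gt0 // dvdn_leq.
have e'0 : (0 < e')%N by rewrite divn_gt0 // dvdn_leq.
have mY : (a' * e' <= y ^ 2)%N.
  rewrite expnS expn1 leq_mul //; first by apply: leq_trans (leq_div _ _) _; lia.
  by apply: leq_trans (leq_div _ _) _.
rewrite (bigD1_seq (a' * e')%N) ?iota_uniq //=; last by rewrite mem_index_iota ltnS mY muln_gt0 a'0 e'0.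
have me : (a' * e' * d * f)%N = n by rewrite nE -aE -eE; lia.
rewrite ifT; last first.
  apply/hasP; exists a'; first by rewrite -dvdn_divisors ?dvdn_mulr // muln_gt0 a'0.
  rewrite dvdn_mulr //= mulKn // aE eE ny andbT; lia.
rewrite me eqxx !mul1r -[leLHS]addr0; apply: lerD; last exact: sumr_ge0.
rewrite le_eqVlt; apply/orP; left; apply/eqP.
have -> : Num.sqrt n%:R = Num.sqrt d%:R * Num.sqrt f%:R * Num.sqrt (a' * e')%:R :> R.
  by rewrite -!sqrtrM ?mulr_ge0 // -!natrM; congr Num.sqrt; congr _%:R; rewrite -me; lia.
by rewrite !invfM; ring.
Qed.

Lemma sum_mtab_le y : (0 < y)%N -> (ln y%:R) ^+ 2 / 4 * (\sum_(n <- mtab y) (Num.sqrt n%:R)^-1) <=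
  \sum_(1 <= m < (y ^ 2).+1) region_sum y m / Num.sqrt m%:R +
  (ln y%:R) ^+ 2 / 4 * (8 * (Num.sqrt (Num.sqrt y%:R) * Num.sqrt y%:R)) :> R.
Proof.
move=> y0; rewrite (bigID (balanced y)) /= mulrDr lerD //.
  rewrite mulr_sumr; apply: le_trans (sum_T y); rewrite big_mkcond /=.
  apply: ler_sum => n _; case: ifP => [/T_balanced|_]; first exact.
  apply: sumr_ge0 => m _; apply: sumr_ge0 => d _; apply: sumr_ge0 => e _.
  by rewrite mulr_ge0 ?term_ge0.
by rewrite ler_wpM2l ?divr_ge0 ?sqr_ge0 // sum_mtab_unbalanced.
Qed.

(* Ford's sharp theorem has 3/2 in place of 3/4; any exponent above 1/2 makes the
   series in the Borel-Cantelli argument converge. *)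
Lemma mtab_sum_bound : exists2 C : R, 0 < C & forall y : nat,
  22 <= ln (ln y%:R) :> R ->
  \sum_(n <- mtab y) (Num.sqrt n%:R)^-1 <=
    C * y%:R * expR (- c_const * ln (ln y%:R)) * expR (- (3 / 4) * ln (ln (ln y%:R))).
Proof.
have [C1 C10 HC] := @sum_region_sum R.
have /andP[c1 c2] := @ln2_bounds R; have c0 : 0 < c by lra.
have [b1 cb] := @lnln2_bounds R.
(* This exponent is [2 - c_const], so that division by [(ln y)^2] leaves [(ln y)^(- c_const)]. *)
set k := (c + b + 1) / c in HC.
have kE : c_const = 2 - k by rewrite /c_const /k; field; rewrite gt_eqF.
have k1 : 1 <= k by rewrite /k ler_pdivlMr //; lra.
exists (4 * C1 * expR (14 * k + 1) + 8 * expR 12).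
  by rewrite addr_gt0 ?mulr_gt0 ?expR_gt0.
move=> y; set l := ln y%:R; set ll := ln l; set lll := ln ll => hl.
have l0 : 0 < l by rewrite ltNge; apply/negP => /ln0 E; move: hl; rewrite /ll E; lra.
have y0 : (0 < y)%N by rewrite lt0n; apply: contraTneq l0 => E; rewrite /l E ln0 // ltxx.
have Y0 : 0 < y%:R :> R by rewrite ltr0n.
have lE : l = expR ll by rewrite lnK.
have llE : ll = expR lll by rewrite lnK // posrE; lra.
have l1 : 23 <= l by rewrite lE; have := expR_ge1Dx ll; lra.
set X : R := prsum (y ^ 2).
have lY : ln (y ^ 2)%:R = 2 * l by rewrite natrX lnXn // mulr_natl.
have y2 : (2 <= y ^ 2)%N.
  rewrite ltnNge; apply/negP => h; have : ln (y ^ 2)%:R <= 0 :> R by rewrite ln_le0 // -[leRHS]/(1%:R) ler_nat.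
  by rewrite lY; lra.
(* [X] is [ln (ln y)] up to a bounded error: the upper bound serves the exponential, the lower bound
   the saving [X^(-3/4)]. *)
have Xle : X <= ll + 14.
  have := @prsum_le R _ y2; rewrite lY lnM ?posrE // -/X -/ll; lra.
have Xge : ll - 11 <= X.
  have := @ln_le_expR_prsum R (y ^ 2); rewrite lY -/X => h.
  have h2 : l <= expR (11 + X).
    apply: le_trans (_ : 12 * expR X <= _); first by lra.
    by rewrite expRD ler_wpM2r ?expR_ge0 //; have := expR_ge1Dx (11 : R); lra.
  have : ll <= 11 + X by rewrite -(expRK (11 + X)) ler_ln ?posrE ?expR_gt0.
  lra.
have X1 : 1 <= X by lra.
(* The threshold 22 is twice the error 11 in [Xge]. *)
have X2 : ll / 2 <= X by lra.
have lX : lll - c <= ln X.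
  have ll0 : 0 < ll by lra.
  rewrite -[lll - c]ln_div ?posrE // ler_ln ?posrE //; [by rewrite divr_gt0|lra].
set Z := \sum_(n <- _) _.
have := sum_mtab_le y0; rewrite -/Z -/l => hZ.
have hR := HC y y0 X1; rewrite -/X in hR.
set sq := Num.sqrt (Num.sqrt y%:R) * Num.sqrt y%:R in hZ.
have sqE : sq = y%:R * expR (- (l / 4)).
  have e2 : Num.sqrt y%:R = expR (l / 2).
    apply/eqP; rewrite -(@eqrXn2 _ 2) ?sqrtr_ge0 ?expR_ge0 // sqr_sqrtr //.
    by rewrite -expRM_natl mulrC mulfVK // lnK.
  have e4 : Num.sqrt (Num.sqrt y%:R) = expR (l / 4).
    apply/eqP; rewrite -(@eqrXn2 _ 2) ?sqrtr_ge0 ?expR_ge0 // sqr_sqrtr ?sqrtr_ge0 //.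
    by rewrite e2 -expRM_natl; apply/eqP; congr expR; field.
  have yE : y%:R = expR l by rewrite lnK.
  by rewrite /sq e4 e2 yE -!expRD; congr expR; lra.
set E := expR (- c_const * ll) * expR (- (3 / 4) * lll).
have E0 : 0 < E by rewrite mulr_gt0 ?expR_gt0.
(* [E] is at least [exp (- 2 * ll)], and [2 * ll <= l / 4 + 12]. *)
have part2 : 8 * sq <= 8 * expR 12 * y%:R * E.
  rewrite sqE [leRHS](_ : _ = 8 * (y%:R * (expR 12 * E))); last by ring.
  rewrite ler_pM2l // ler_pM2l // /E -!expRD ler_expR kE.
  have h1 : lll <= ll by rewrite llE; have := expR_ge1Dx lll; lra.
  have h2 : ll <= l / 8 + 6.
    have l8 : 0 < l / 8 by rewrite divr_gt0.
    have := ln_sublinear l8; rewrite ln_div ?posrE //.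
    have := @ln_sublinear R 8 ltac:(lra).
    have e8 : ln 8 = 3 * c :> R.
      by rewrite (_ : 8 = 2 ^+ 3); [rewrite lnXn // mulr_natl|rewrite !exprS expr0; lra].
    rewrite -/ll e8; lra.
  have : 0 <= (k - 1) * ll by rewrite mulr_ge0; lra.
  lra.
have part1 : C1 * y%:R * (expR (k * X) * expR (- (3 / 4) * ln X)) <=
   l ^+ 2 / 4 * (4 * C1 * expR (14 * k + 1) * y%:R * E).
  rewrite [leRHS](_ : _ = C1 * y%:R * (l ^+ 2 * expR (14 * k + 1) * E)); last by field.
  rewrite ler_wpM2l ?mulr_ge0 ?(ltW C10) ?(ltW Y0) //.
  have -> : l ^+ 2 = expR (2 * ll) by rewrite lE expRM_natl -lE.
  rewrite /E -!expRD ler_expR kE.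
  have : k * X <= k * (ll + 14) by rewrite ler_wpM2l //; lra.
  lra.
have l20 : 0 < l ^+ 2 / 4 by rewrite divr_gt0 ?exprn_gt0.
rewrite -mulrA -/E -(ler_pM2l l20); apply: le_trans hZ _.
rewrite [leRHS](_ : _ = l ^+ 2 / 4 * (4 * C1 * expR (14 * k + 1) * y%:R * E) +
   l ^+ 2 / 4 * (8 * expR 12 * y%:R * E)); last by ring.
apply: lerD; first exact: le_trans part1.
by rewrite ler_pM2l.
Qed.

End MultiplicationTable.


(** * Gaps and exceptional sets *)

Section Gaps.
Context {R : realType}.
Implicit Types (alpha eta : R) (lam : nat -> R).

(* Two values of the form differ by [alpha (m1^2 - m2^2) + (n1^2 - n2^2)], and
   [m1^2 - m2^2 = (m1 - m2) (m1 + m2)] belongs to a multiplication table. *)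
Definition exceptional (r y : nat) (eta : R) : set R :=
  [set alpha | exists A B, [/\ A \in mtab y, B \in mtab y, (B <= r.+1 * A)%N &
     `|alpha * A%:R - B%:R| <= eta]].

Lemma form_inj alpha : ~ (exists q : rat, alpha = ratr q) ->
  forall m n m' n' : nat,
  alpha * m%:R ^+ 2 + n%:R ^+ 2 = alpha * m'%:R ^+ 2 + n'%:R ^+ 2 -> m = m' /\ n = n'.
Proof.
move=> irr m n m' n' E.
have natsq (a e : nat) : a%:R ^+ 2 = e%:R ^+ 2 :> R -> a = e.
  by rewrite -!natrX => /eqP; rewrite eqr_nat eqn_exp2r // => /eqP.
have [mm|mm] := eqVneq m m'.
  by split => //; apply: natsq; move: E; rewrite mm => /addrI.
exfalso; apply: irr; exists ((n'%:R ^+ 2 - n%:R ^+ 2) / (m%:R ^+ 2 - m'%:R ^+ 2)).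
rewrite fmorph_div /= 2!rmorphB /= !rmorphXn /= !ratr_nat.
have D : m%:R ^+ 2 - m'%:R ^+ 2 != 0 :> R.
  by rewrite subr_eq0; apply/negP => /eqP /natsq h; rewrite h eqxx in mm.
apply: (mulIf D); rewrite mulfVK // mulrBr; lra.
Qed.

Lemma sorted_enum_le alpha lam : sorted_enum alpha lam ->
  forall i j : nat, (i <= j)%N -> lam i <= lam j.
Proof.
move=> [inc _] i j; rewrite leq_eqVlt => /orP[/eqP -> //|/inc /ltW //].
Qed.

(** Pigeonhole: the [z^2] values with [m, n <= z] are at most [(r + 1) * z^2] and, by irrationality,
    distinct; were [lam N] larger, they would all be among the first [N] terms. *)
Lemma sorted_enum_bound alpha lam (r N z : nat) : 0 < alpha <= r%:R ->
  ~ (exists q : rat, alpha = ratr q) -> sorted_enum alpha lam ->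
  (N < z ^ 2)%N -> lam N <= r.+1%:R * z%:R ^+ 2.
Proof.
move=> /andP[a0 ar] irr se Nz; rewrite leNgt; apply/negP => big.
have [inc ran] := se.
have small (m n : 'I_z) : exists j : 'I_N, lam j = alpha * m.+1%:R ^+ 2 + n.+1%:R ^+ 2.
  have : specset alpha (alpha * m.+1%:R ^+ 2 + n.+1%:R ^+ 2) by exists m.+1, n.+1.
  rewrite -ran => -[j _ E].
  have jN : (j < N)%N.
    rewrite ltnNge; apply/negP => /(sorted_enum_le se); rewrite leNgt => /negP; apply.
    apply: le_lt_trans big; rewrite E -(natr1 r) mulrDl mul1r lerD //.
      by rewrite ler_pM ?exprn_ge0 ?lerXn2r ?nnegrE ?ler_nat // ltW.
    by rewrite lerXn2r ?nnegrE ?ler_nat.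
  by exists (Ordinal jN).
have [f fP] : exists f : 'I_z * 'I_z -> 'I_N, forall p, lam (f p) = alpha * p.1.+1%:R ^+ 2 + p.2.+1%:R ^+ 2.
  have := @choice _ _ (fun (p : 'I_z * 'I_z) (j : 'I_N) =>
    lam j = alpha * p.1.+1%:R ^+ 2 + p.2.+1%:R ^+ 2).
  by case=> [p|f fP]; [exact: small|exists f].
have finj : injective f.
  move=> [m n] [m' n'] E; have := fP (m, n); rewrite E fP /= => /(form_inj irr)[[h1] [h2]].
  by congr pair; apply: val_inj.
have := leq_card f finj; rewrite card_prod !card_ord => h.
by move: Nz; rewrite expnS expn1 ltnNge h.
Qed.

Lemma mtab_diff_sqr (m m' y : nat) : (m' < m)%N -> (m + m' <= y)%N ->
  (m ^ 2 - m' ^ 2)%N \in mtab y.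
Proof.
move=> mm my; apply/mem_mtab; exists (m - m')%N, (m + m')%N.
by rewrite subn_sqr; split => //; lia.
Qed.

(** Between consecutive values [m] and [n] move in opposite directions, since otherwise the
    difference is not positive or is at least [1 / r > eta]. So [A] and [B] are positive differences
    of squares of numbers up to [r.+1 * z]. *)
Lemma small_gap_exceptional alpha lam (r N z : nat) eta i :
  (0 < r)%N -> r%:R^-1 <= alpha <= r%:R ->
  ~ (exists q : rat, alpha = ratr q) -> sorted_enum alpha lam ->
  (N < z ^ 2)%N -> eta < r%:R^-1 -> (i < N)%N -> lam i.+1 - lam i <= eta ->
  exceptional r (2 * r.+1 * z) eta alpha.
Proof.
move=> r0 /andP[ra ar] irr se Nz er iN gap.
have rp : 0 < r%:R^-1 :> R by rewrite invr_gt0 ltr0n.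
have a0 : 0 < alpha by lra.
have r1 : r%:R^-1 <= 1 :> R by rewrite invf_le1 ?ltr0n // ler1n.
have lamN j : (j <= N)%N -> lam j <= r.+1%:R * z%:R ^+ 2.
  move=> jN; apply: le_trans (sorted_enum_le se jN) _.
  by apply: sorted_enum_bound se Nz => //; rewrite a0.
have [inc ran] := se.
have rep j : (j <= N)%N -> exists m n, [/\ (0 < m <= r.+1 * z)%N, (0 < n <= r.+1 * z)%N &
    lam j = alpha * m%:R ^+ 2 + n%:R ^+ 2].
  move=> jN; have : range lam (lam j) by exists j.
  rewrite ran => -[m [n [m1 [n1 E]]]]; exists m, n; rewrite m1 n1 /=.
  have := lamN _ jN; rewrite E => le.
  have am0 : 0 <= alpha * m%:R ^+ 2 by rewrite mulr_ge0 ?exprn_ge0 // ltW.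
  have nn0 : 0 <= n%:R ^+ 2 :> R by rewrite exprn_ge0.
  split => //.
    have : r%:R^-1 * m%:R ^+ 2 <= r.+1%:R * z%:R ^+ 2 :> R.
      by apply: le_trans (_ : alpha * m%:R ^+ 2 <= _); [rewrite ler_wpM2r ?exprn_ge0|lra].
    rewrite ler_pdivrMl ?ltr0n // -!natrX -!natrM ler_nat => h.
    rewrite -(leq_exp2r _ _ (isT : 0 < 2)%N); apply: leq_trans h _.
    by rewrite expnMn mulnA leq_mul2r expnS expn1 leq_mul2r leqnSn !orbT.
  have : n%:R ^+ 2 <= r.+1%:R * z%:R ^+ 2 :> R by lra.
  rewrite -!natrX -!natrM ler_nat => h.
  rewrite -(leq_exp2r _ _ (isT : 0 < 2)%N); apply: leq_trans h _.
  by rewrite expnMn leq_mul2r expnS expn1 leq_pmull ?orbT.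
have [m1 [n1 [m1b n1b E1]]] := rep i (ltnW iN).
have [m2 [n2 [m2b n2b E2]]] := rep i.+1 iN.
have pos : 0 < lam i.+1 - lam i by rewrite subr_gt0 inc.
have sq_lt (a e : nat) : (a < e)%N -> a%:R ^+ 2 + 1 <= e%:R ^+ 2 :> R.
  by move=> ae; rewrite -!natrX natr1 ler_nat ltn_exp2r.
have sq_le (a e : nat) : (a <= e)%N -> a%:R ^+ 2 <= e%:R ^+ 2 :> R.
  by move=> ae; rewrite -!natrX ler_nat leq_exp2r.
have natB (a e : nat) : (a < e)%N -> (e ^ 2 - a ^ 2)%N%:R = e%:R ^+ 2 - a%:R ^+ 2 :> R.
  by move=> ae; rewrite natrB ?natrX // leq_exp2r // ltnW.
rewrite E1 E2 in gap pos.
have B_le (A B : nat) : (0 < A)%N -> `|alpha * A%:R - B%:R| <= eta -> (B <= r.+1 * A)%N.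
  move=> A0 h; rewrite -(ler_nat R) natrM -(natr1 r) mulrDl mul1r.
  have : alpha * A%:R <= r%:R * A%:R by rewrite ler_wpM2r.
  have : 1 <= A%:R :> R by rewrite ler1n.
  by move: h; rewrite ler_norml => /andP[h _]; lra.
have diff_gt0 (a e : nat) : (a < e)%N -> (0 < e ^ 2 - a ^ 2)%N by move=> ae; rewrite subn_gt0 ltn_exp2r.
have [m12|m21|mE] := ltngtP m1 m2.
- have h1 := sq_lt _ _ m12.
  have [n21|n12] := ltnP n2 n1.
    have h : `|alpha * (m2 ^ 2 - m1 ^ 2)%N%:R - (n1 ^ 2 - n2 ^ 2)%N%:R| <= eta.
      rewrite !natB // (_ : _ - _ = alpha * m2%:R ^+ 2 + n2%:R ^+ 2 - (alpha * m1%:R ^+ 2 + n1%:R ^+ 2)); last by ring.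
      by rewrite gtr0_norm.
    exists (m2 ^ 2 - m1 ^ 2)%N, (n1 ^ 2 - n2 ^ 2)%N; split => //.
    + by apply: mtab_diff_sqr => //; clear -m1b m2b; lia.
    + by apply: mtab_diff_sqr => //; clear -n1b n2b; lia.
    + by apply: B_le h; exact: diff_gt0.
  have h2 := sq_le _ _ n12; have := ler_wpM2l (ltW a0) h1.
  by rewrite mulrDr mulr1; lra.
- have h1 := sq_lt _ _ m21.
  have [n12|n21] := ltnP n1 n2.
    have h : `|alpha * (m1 ^ 2 - m2 ^ 2)%N%:R - (n2 ^ 2 - n1 ^ 2)%N%:R| <= eta.
      rewrite !natB // (_ : _ - _ = - (alpha * m2%:R ^+ 2 + n2%:R ^+ 2 - (alpha * m1%:R ^+ 2 + n1%:R ^+ 2))); last by ring.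
      by rewrite normrN gtr0_norm.
    exists (m1 ^ 2 - m2 ^ 2)%N, (n2 ^ 2 - n1 ^ 2)%N; split => //.
    + by apply: mtab_diff_sqr => //; clear -m1b m2b; lia.
    + by apply: mtab_diff_sqr => //; clear -n1b n2b; lia.
    + by apply: B_le h; exact: diff_gt0.
  have h2 := sq_le _ _ n21; have := ler_wpM2l (ltW a0) h1.
  by rewrite mulrDr mulr1; lra.
- rewrite mE in gap pos.
  have [n12|n21] := ltnP n1 n2; first by have := sq_lt _ _ n12; lra.
  by have := sq_le _ _ n21; lra.
Qed.

Lemma delta_min_gt alpha lam (r N z : nat) eta :
  (0 < r)%N -> r%:R^-1 <= alpha <= r%:R ->
  ~ (exists q : rat, alpha = ratr q) -> sorted_enum alpha lam ->
  (0 < N < z ^ 2)%N -> eta < r%:R^-1 -> ~ exceptional r (2 * r.+1 * z) eta alpha ->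
  eta < delta_min lam N.
Proof.
move=> r0 ra irr se /andP[N0 Nz] er nex.
have gap i : (i < N)%N -> eta < lam i.+1 - lam i.
  by move=> iN; rewrite ltNge; apply/negP => h; apply: nex; apply: (small_gap_exceptional r0 ra irr se Nz er iN h).
by apply/lt_bigmin => [|i _]; [exact: gap|exact: gap].
Qed.

Lemma specset_initial_finite alpha (x : R) : 0 < alpha ->
  finite_set (specset alpha `&` [set t | t <= x]).
Proof.
move=> a0; pose K := (Num.truncn (`|x| / alpha + `|x|)).+1.
pose f (p : nat * nat) := alpha * p.1%:R ^+ 2 + p.2%:R ^+ 2.
apply: (@sub_finite_set _ _ (f @` (`I_K `*` `I_K))); last first.
  by apply: finite_image; apply: finite_setX; exact: finite_II.
move=> t [[m [n [m1 [n1 ->]]]] /= h]; exists (m, n) => //=.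
have q0 : 0 <= `|x| / alpha by rewrite divr_ge0 // ltW.
have xx := ler_norm x.
have sq (k : nat) : k%:R <= k%:R ^+ 2 :> R by rewrite -natrX ler_nat expnS expn1; nia.
have hK : `|x| / alpha + `|x| < K%:R by exact: truncnS_gt.
have m0 : 0 <= alpha * m%:R ^+ 2 by rewrite mulr_ge0 ?exprn_ge0 // ltW.
have n0 : 0 <= n%:R ^+ 2 :> R by rewrite exprn_ge0.
have := sq m; have := sq n => sn sm.
split; rewrite /= -(ltr_nat R); apply: le_lt_trans hK.
  have : m%:R <= `|x| / alpha.
    rewrite ler_pdivlMr // mulrC; apply: le_trans (_ : alpha * m%:R ^+ 2 <= _); last lra.
    by rewrite ler_pM2l.
  by have := normr_ge0 x; lra.
lra.
Qed.

(** Iterates the map sending [t] to the least value above [t]; a value never reached would lie above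
    infinitely many others, against [specset_initial_finite]. *)
Lemma sorted_enum_exists alpha : 0 < alpha -> exists lam, sorted_enum alpha lam.
Proof.
move=> a0.
have above t : exists x, specset alpha x /\ t < x.
  pose n := (Num.truncn `|t|).+1.
  exists (alpha * 1%:R ^+ 2 + n%:R ^+ 2); split; first by exists 1%N, n.
  have : `|t| < n%:R by exact: truncnS_gt.
  have : n%:R <= n%:R ^+ 2 :> R by rewrite -natrX ler_nat expnS expn1 /n; nia.
  by have := ler_norm t; rewrite expr1n mulr1; lra.
have next t : exists x, [/\ specset alpha x, t < x & forall z, specset alpha z -> t < z -> x <= z].
  have [x0 [sx0 tx0]] := above t.
  pose S := specset alpha `&` [set z | z <= x0] `&` [set z | t < z].
  have finS : finite_set S by apply: finite_setIl; exact: specset_initial_finite.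
  have /finite_seqP[s sE] := finS.
  have xs : x0 \in s.
    have : S x0 by split => //; split => //=.
    by rewrite sE.
  pose m := \big[Num.min/x0]_(z <- s) z.
  have ms : m \in s.
    rewrite /m; have : {subset s <= s} by [].
    elim: {1 3}s => [|z s' IH] sub; first by rewrite big_nil.
    rewrite big_cons minEle; case: ifP => _; first by apply: sub; rewrite mem_head.
    by apply: IH => w ws; apply: sub; rewrite inE ws orbT.
  have [[sm _] tm] : S m by rewrite sE.
  exists m; split => // z sz tz.
  have mle w : w \in s -> m <= w by move=> ws; apply: (@ge_bigmin_seq _ _ _ s x0 w xpredT id ws isT).
  have [zx|/ltW xz] := leP z x0; last by apply: le_trans xz; exact: mle.
  apply: mle; have : S z by split => //; split.
  by rewrite sE.
have [nxt nxtP] := choice next.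
pose lam := fix F n := if n is n'.+1 then nxt (F n') else nxt 0.
have lamS n : lam n.+1 = nxt (lam n) by [].
have inc1 n : lam n < lam n.+1 by have [] := nxtP (lam n).
have inc i j : (i < j)%N -> lam i < lam j.
  elim: j => // j IH; rewrite ltnS leq_eqVlt => /orP[/eqP ->|/IH h]; first exact: inc1.
  exact: lt_trans (inc1 j).
have lam_spec n : specset alpha (lam n).
  by case: n => [|n]; [have [] := nxtP 0|have [] := nxtP (lam n)].
exists lam; split => //; apply/seteqP; split => [_ [n _ <-] //|x sx].
apply: contrapT => nx.
have x0 : 0 < x.
  have [m [n [m1 [n1 ->]]]] := sx.
  by rewrite addr_gt0 ?mulr_gt0 ?exprn_gt0 ?ltr0n.
have lt_x n : lam n < x.
  have ne k : lam k != x by apply/eqP => E; apply: nx; exists k.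
  elim: n => [|n IH]; rewrite lt_neqAle ne /=.
    by have [_ _] := nxtP 0; apply.
  by have [_ _] := nxtP (lam n); apply.
have linj : injective lam.
  move=> i j E; case: (ltngtP i j) => // /inc; rewrite E ltxx //.
have fin := specset_initial_finite x a0.
apply: infinite_nat; apply: (@sub_finite_set _ _ (lam @^-1` (specset alpha `&` [set t | t <= x]))).
  by move=> n _; split => //=; exact: ltW.
by apply: finite_preimage => // i j _ _; exact: linj.
Qed.

End Gaps.


(** * Measure of the exceptional sets and Borel-Cantelli *)

Section Measure.
Context {R : realType}.
Notation mu := (@lebesgue_measure R).

Lemma measure_bigsetU_seq_le (I : Type) (s : seq I) (F : I -> set R) :
  (forall i, measurable (F i)) ->
  measurable (\big[setU/set0]_(i <- s) F i) /\
  (mu (\big[setU/set0]_(i <- s) F i) <= \sum_(i <- s) mu (F i))%E.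
Proof.
move=> mF; elim: s => [|i s [mS IH]]; first by rewrite !big_nil measure0.
rewrite !big_cons; split; first exact: measurableU.
have h := @measureU2 _ _ _ mu (F i) _ (mF i) mS.
by apply: (le_trans h); rewrite leeD2l.
Qed.

Lemma lebesgue_measure_itv_le (a e : R) : a <= e -> (mu `[a, e]%classic <= (e - a)%:E)%E.
Proof.
move=> ae; rewrite lebesgue_measure_itv /=; case: ifP => // _.
by rewrite lee_fin subr_ge0.
Qed.

Let pairs (r y : nat) : seq (nat * nat) :=
  [seq p <- [seq (A, B) | A <- mtab y, B <- mtab y] | (p.2 <= r.+1 * p.1)%N].

Let slab (eta : R) (p : nat * nat) : set R :=
  `[(p.2%:R - eta) / p.1%:R, (p.2%:R + eta) / p.1%:R]%classic.

Let mtab_gt0 y A : A \in mtab y -> (0 < A)%N.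
Proof. by move=> /mem_mtab[a [e [/andP[a0 _] /andP[e0 _] ->]]]; rewrite muln_gt0 a0. Qed.

Let exceptionalE r y (eta : R) :
  exceptional r y eta = \big[setU/set0]_(p <- pairs r y) slab eta p.
Proof.
rewrite -bigcup_seq; apply/seteqP; split => [a [A [B [Ay By BA h]]]|a [[A B] /=]].
  exists (A, B) => /=; first by rewrite mem_filter /= BA allpairs_f.
  have A0 : 0 < A%:R :> R by rewrite ltr0n (mtab_gt0 Ay).
  rewrite /slab /= in_itv /= ler_pdivrMr // ler_pdivlMr //.
  by move: h; rewrite ler_norml => /andP[h1 h2]; apply/andP; split; lra.
rewrite mem_filter /= => /andP[BA /allpairsP[[A' B'] /= [Ay By [EA EB]]]].
rewrite -EA -EB in Ay By; rewrite /slab /= in_itv /=.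
have A0 : 0 < A%:R :> R by rewrite ltr0n (mtab_gt0 Ay).
rewrite ler_pdivrMr // ler_pdivlMr // => /andP[h1 h2].
exists A, B; split => //; rewrite ler_norml; apply/andP; split; lra.
Qed.

Lemma measurable_exceptional r y (eta : R) : measurable (exceptional r y eta).
Proof.
rewrite exceptionalE; have [] // := @measure_bigsetU_seq_le _ (pairs r y) (slab eta).
by move=> p; exact: measurable_itv.
Qed.

(** A pair [(A, B)] contributes an interval of length [2 * eta / A]. The restriction [B <= r.+1 * A]
    gives [1 / A <= r.+1 / sqrt (A * B)], which makes the double sum a square. *)
Lemma measure_exceptional_le r y (eta : R) : 0 <= eta ->
  (mu (exceptional r y eta) <=
   (2 * eta * r.+1%:R * (\sum_(n <- mtab y) (Num.sqrt n%:R)^-1) ^+ 2)%:E)%E.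
Proof.
move=> eta0; rewrite exceptionalE.
have [_] := @measure_bigsetU_seq_le _ (pairs r y) (slab eta) (fun p => measurable_itv _).
move=> /le_trans; apply.
set x := fun n : nat => (Num.sqrt n%:R)^-1 : R.
have x0 n : 0 <= x n by rewrite invr_ge0 sqrtr_ge0.
rewrite expr2 big_distrlr /= mulr_sumr -sumEFin.
rewrite /pairs big_filter big_mkcond /= big_allpairs /=.
rewrite [leLHS]big_seq [leRHS]big_seq; apply: lee_sum => A Ay.
rewrite mulr_sumr -sumEFin [leLHS]big_seq [leRHS]big_seq; apply: lee_sum => B By.
have A0 : 0 < A%:R :> R by rewrite ltr0n (mtab_gt0 Ay).
have B0 : 0 < B%:R :> R by rewrite ltr0n (mtab_gt0 By).
case: ifP => BA; last by rewrite lee_fin !mulr_ge0.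
apply: le_trans (lebesgue_measure_itv_le _) _.
  by rewrite ler_pM2r ?invr_gt0 //=; lra.
rewrite lee_fin /= -mulrBl (_ : _ + eta - _ = 2 * eta); last by ring.
rewrite -[leRHS]mulrA ler_wpM2l ?mulr_ge0 //.
have sA : 0 < Num.sqrt A%:R :> R by rewrite sqrtr_gt0.
have sB : 0 < Num.sqrt B%:R :> R by rewrite sqrtr_gt0.
rewrite /x -invfM ler_pdivlMr ?mulr_gt0 // mulrC ler_pdivrMr //.
have E : A%:R = Num.sqrt A%:R * Num.sqrt A%:R :> R by rewrite -expr2 sqr_sqrtr // ltW.
have BA' : Num.sqrt B%:R <= Num.sqrt r.+1%:R * Num.sqrt A%:R :> R.
  by rewrite -sqrtrM // ler_wsqrtr // -natrM ler_nat.
have r1 : Num.sqrt r.+1%:R <= r.+1%:R :> R.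
  rewrite -[leRHS]ger0_norm // -sqrtr_sqr ler_wsqrtr // -natrX ler_nat; nia.
rewrite [X in _ <= _ * X]E mulrCA ler_wpM2l ?sqrtr_ge0 //.
by apply: le_trans BA' _; rewrite ler_wpM2r // ltW.
Qed.

Lemma negligible_lim_sup (F : nat -> set R) (u : nat -> R) (M : R) :
  (forall n, measurable (F n)) -> (forall n, (mu (F n) <= (u n)%:E)%E) ->
  (forall n, \sum_(i < n) u i <= M) ->
  mu.-negligible (lim_sup_set F).
Proof.
move=> mF Fu uM; apply/negligibleP.
  by apply: bigcap_measurable => // k _; apply: bigcup_measurable => j _; exact: mF.
apply: lim_sup_set_cvg0 => //.
apply: (@le_lt_trans _ _ M%:E); last exact: ltry.
apply: lime_le; first exact: is_cvg_nneseries.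
apply: nearW => n; apply: le_trans (_ : (\sum_(0 <= i < n) (u i)%:E <= _)%E).
  by apply: lee_sum => i _; exact: Fu.
by rewrite sumEFin lee_fin big_mkord.
Qed.

Lemma negligible_bigcap (F : nat -> set R) (u : nat -> R) :
  (forall n, measurable (F n)) -> (forall n, (mu (F n) <= (u n)%:E)%E) ->
  (forall e : R, 0 < e -> exists n, u n <= e) ->
  mu.-negligible (\bigcap_n F n).
Proof.
move=> mF Fu ulim; have mI : measurable (\bigcap_n F n) by apply: bigcap_measurable => // k _.
apply/negligibleP => //; apply/eqP; rewrite -measure_le0; apply/lee_addgt0Pr => e e0.
rewrite add0e; have [n ne] := ulim e e0.
apply: le_trans (_ : (u n)%:E <= _)%E; last by rewrite lee_fin.
apply: le_trans (Fu n); apply: le_measure; rewrite ?inE //; first exact: mF.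
exact: bigcap_inf.
Qed.

End Measure.


(** * Thresholds and measures at the scales [4^k] *)

Section Scales.
Context {R : realType}.
Notation mu := (@lebesgue_measure R).
Notation c := (@c_const R).

Lemma c_const_bounds : 0 <= 2 * c <= 1.
Proof.
have /andP[c1 c2] := @ln2_bounds R; have c0 : 0 < ln 2 :> R by lra.
have [b1 cb] := @lnln2_bounds R.
have : (1 + ln (ln 2)) / ln 2 <= 1 :> R.
  rewrite ler_pdivrMr // mul1r; have := @le_ln1Dx R (ln 2 - 1) ltac:(lra).
  by rewrite addrCA subrr addr0; lra.
have : 1 / 2 <= (1 + ln (ln 2)) / ln 2 :> R by rewrite ler_pdivlMr //; lra.
by rewrite /c_const; lra.
Qed.

Definition eta_weak (k : nat) : R := powR (logm (4 ^ k)%:R) (2 * c) / (4 ^ k)%:R.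

Definition eta_strong (k : nat) : R :=
  powR (logm (4 ^ k)%:R) (2 * c) / ((4 ^ k)%:R * logm (4 ^ k)%:R).

Lemma logm_ge1 (x : R) : 1 <= logm x.
Proof. by rewrite /logm le_max lexx. Qed.

Lemma ln_pow4 k : ln (4 ^ k)%:R = 2 * ln 2 * k%:R :> R.
Proof.
rewrite natrX lnXn // [RHS]mulr_natr; congr (_ *+ _).
have -> : 4 = 2 * 2 :> R by lra.
by rewrite lnM ?posrE //; lra.
Qed.

Lemma le_logm_pow4 k : k%:R <= logm (4 ^ k)%:R :> R.
Proof.
have /andP[c1 _] := @ln2_bounds R.
rewrite /logm le_max ln_pow4; apply/orP; right.
by rewrite ler_peMl //; lra.
Qed.

Lemma logm_pow4_le k : logm (4 ^ k)%:R <= 2 * k%:R + 1 :> R.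
Proof.
have /andP[_ c2] := @ln2_bounds R; have k0 : 0 <= k%:R :> R by [].
rewrite /logm ge_max ln_pow4; apply/andP; split; first lra.
have : ln 2 * k%:R <= 1 * k%:R :> R by rewrite ler_wpM2r //; lra.
lra.
Qed.

Lemma le_logm (x y : R) : 0 < x -> x <= y -> logm x <= logm y.
Proof.
move=> x0 xy; rewrite /logm ge_max !le_max lexx /= ler_ln ?posrE ?xy ?orbT //.
exact: lt_le_trans xy.
Qed.

Lemma eta_weak_ge0 k : 0 <= eta_weak k.
Proof. by rewrite /eta_weak divr_ge0 ?powR_ge0. Qed.

Lemma eta_strongE k : eta_strong k = eta_weak k / logm (4 ^ k)%:R.
Proof. by rewrite /eta_strong /eta_weak invfM mulrA. Qed.

Lemma eta_strong_le_weak k : eta_strong k <= eta_weak k.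
Proof.
rewrite eta_strongE ler_pdivrMr; last by rewrite (lt_le_trans ltr01) ?logm_ge1.
by rewrite ler_peMr ?eta_weak_ge0 ?logm_ge1.
Qed.

Lemma mul_lt_pow4 k : (k * (2 * k + 1) < 4 ^ k)%N.
Proof.
have [->//|] := posnP k; elim: k => // k IH _.
have [->//|k0] := posnP k.
by have := IH k0; rewrite expnS; nia.
Qed.

Lemma eta_weak_lt r k : (0 < r <= k)%N -> eta_weak k < r%:R^-1.
Proof.
move=> /andP[r0 rk]; have /andP[_ c1] := c_const_bounds.
have R0 : 0 < r%:R :> R by rewrite ltr0n.
rewrite /eta_weak ltr_pdivrMr; last by rewrite ltr0n expn_gt0.
rewrite ltr_pdivlMl // mulrC.
have h : powR (logm (4 ^ k)%:R) (2 * c) <= 2 * k%:R + 1 :> R.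
  apply: le_trans (logm_pow4_le k); rewrite -[leRHS]powRr1.
    by rewrite ler_powR // logm_ge1.
  by rewrite (le_trans ler01) // logm_ge1.
apply: le_lt_trans (_ : (2 * k%:R + 1) * k%:R < _).
  by rewrite ler_pM ?powR_ge0 // ler_nat.
have := mul_lt_pow4 k; rewrite -(ltr_nat R) natrM natrD natrM mulrC.
by [].
Qed.

(** The target [(log N)^(2c - 1) / N] does not increase, because [2c <= 1]; so one threshold serves
    the whole block starting at [4^k]. *)
Lemma target_le_eta_strong k N : (4 ^ k <= N)%N ->
  powR (logm N%:R) (2 * c) / (N%:R * logm N%:R) <= eta_strong k.
Proof.
move=> kN; have /andP[_ c1] := c_const_bounds.
have p4 : 0 < (4 ^ k)%:R :> R by rewrite ltr0n expn_gt0.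
have pN : 0 < N%:R :> R by apply: lt_le_trans p4 _; rewrite ler_nat.
have L1 := @logm_ge1 N%:R; have M1 := @logm_ge1 (4 ^ k)%:R.
have LM : logm (4 ^ k)%:R <= logm N%:R :> R by apply: le_logm => //; rewrite ler_nat.
have L0 : 0 < logm N%:R :> R by lra.
have M0 : 0 < logm (4 ^ k)%:R :> R by lra.
have frac (x : R) : 0 < x -> powR x (2 * c) / x = powR x (2 * c - 1).
  by move=> x0; rewrite /powR gt_eqF // mulrBl mul1r expRB lnK.
have h : powR (logm N%:R) (2 * c) / logm N%:R <= powR (logm (4 ^ k)%:R) (2 * c) / logm (4 ^ k)%:R.
  rewrite !frac // /powR !gt_eqF // ler_expR ler_wnM2l //; first lra.
  by rewrite ler_ln.
rewrite /eta_strong !invfM mulrCA [leRHS]mulrCA.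
have iN : N%:R^-1 <= (4 ^ k)%:R^-1 :> R by rewrite lef_pV2 ?posrE // ler_nat.
by rewrite ler_pM ?invr_ge0 ?divr_ge0 ?powR_ge0 ?(ltW L0).
Qed.

(* Twice a bound for the [m], [n] of the values up to the [N]-th one, for
   [1 / r <= alpha <= r] and [4 ^ k <= N < 4 ^ k.+1]. *)
Definition scale (r k : nat) : nat := (2 * r.+1 * 2 ^ k.+1)%N.

Lemma pow2_le_scale r k : (2 ^ k <= scale r k)%N.
Proof. by rewrite /scale expnS; nia. Qed.

Lemma ln_pow2_le_scale r k : ln 2 * k%:R <= ln (scale r k)%:R :> R.
Proof.
rewrite mulr_natr -lnXn // -natrX ler_ln ?posrE ?ler_nat ?pow2_le_scale ?ltr0n ?expn_gt0 //.
by rewrite /scale muln_gt0 expn_gt0.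
Qed.

Lemma scale_sqr r k : (scale r k)%:R ^+ 2 = 16 * r.+1%:R ^+ 2 * (4 ^ k)%:R :> R.
Proof.
have e4 : ((2 ^ k.+1) ^ 2 = 4 * 4 ^ k)%N by rewrite -expnM mulnC expnM -expnS.
have -> : (scale r k)%:R ^+ 2 = (2 * r.+1%:R) ^+ 2 * ((2 ^ k.+1) ^ 2)%N%:R :> R.
  by rewrite natrX -exprMn; congr (_ ^+ _); rewrite /scale !natrM.
rewrite e4 natrM; move: (4 ^ k)%N => q; ring.
Qed.

(** Bounds the square of the saving [(log log y)^(-3/4)] at [y = scale r k]: there [ln y >= k / 2],
    as [ln 2 >= 1/2]. *)
Definition tail_weight (k : nat) : R := expR (- (3 / 2) * ln (ln (k%:R / 2))).

(** The powers of [log (4^k)] cancel: [eta_weak] carries the exponent [2c], the bound for the square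
    of Z carries [- 2c]. The factor [s] is 1 for the second claim and [1 / logm (4^k)] for the
    first. *)
Lemma measure_scale_le r : exists2 C : R, 0 < C & forall k (s : R), 22 <= ln (k%:R / 2) :> R ->
  0 <= s -> (mu (exceptional r (scale r k) (s * eta_weak k)) <= (C * s * tail_weight k)%:E)%E.
Proof.
have [C C0 HC] := @mtab_sum_bound R.
have /andP[c1 c2] := @ln2_bounds R; have /andP[cc0 cc1] := c_const_bounds.
pose D : R := 2 * 16 * r.+1%:R ^+ 3 * C ^+ 2 * expR (2 * c).
exists D; first by rewrite /D !mulr_gt0 ?exprn_gt0 ?expR_gt0.
move=> k s hk s0; set y := scale r k; set l := ln y%:R : R.
have R0 : 0 < r.+1%:R :> R by [].
have k20 : 0 < k%:R / 2 :> R.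
  by rewrite ltNge; apply/negP => /ln0 E; move: hk; rewrite E; lra.
have kl : k%:R / 2 <= l.
  apply: le_trans (ln_pow2_le_scale r k); rewrite mulrC ler_wpM2r //; lra.
have l0 : 0 < l by apply: lt_le_trans kl.
set ll := ln l.
have kll : ln (k%:R / 2) <= ll by rewrite ler_ln.
have ll0 : 0 < ll by lra.
have klll : ln (ln (k%:R / 2)) <= ln ll by rewrite ler_ln ?posrE //; lra.
have hll : 22 <= ll by lra.
have hZ := HC y hll; rewrite -/l -/ll in hZ.
apply: le_trans (measure_exceptional_le _ _ (mulr_ge0 s0 (eta_weak_ge0 k))) _; rewrite lee_fin.
set Z := \sum_(n <- _) _ in hZ *.
have Z0 : 0 <= Z by apply: sumr_ge0 => n _; rewrite invr_ge0 sqrtr_ge0.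
set W := C * y%:R * _ * _ in hZ.
have hZ2 : Z ^+ 2 <= W ^+ 2 by rewrite lerXn2r ?nnegrE // (le_trans Z0).
have e0 := eta_weak_ge0 k.
apply: le_trans (_ : 2 * (s * eta_weak k) * r.+1%:R * W ^+ 2 <= _).
  by apply: ler_wpM2l => //; do 3 apply: mulr_ge0 => //.
have WE : W ^+ 2 = C ^+ 2 * y%:R ^+ 2 * (expR (- (2 * c) * ll) * expR (- (3 / 2) * ln ll)).
  have E1 : expR (- c * ll) ^+ 2 = expR (- (2 * c) * ll) by rewrite -expRM_natl; congr expR; ring.
  have E2 : expR (- (3 / 4) * ln ll) ^+ 2 = expR (- (3 / 2) * ln ll).
    by rewrite -expRM_natl; congr expR; lra.
  by rewrite /W !exprMn E1 E2; ring.
have p4 : 0 < (4 ^ k)%:R :> R by rewrite ltr0n expn_gt0.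
have yE : y%:R ^+ 2 = 16 * r.+1%:R ^+ 2 * (4 ^ k)%:R :> R by exact: scale_sqr.
have L0 : 0 < logm (4 ^ k)%:R :> R by rewrite (lt_le_trans ltr01) ?logm_ge1.
have Ll : logm (4 ^ k)%:R <= 2 * l.
  rewrite /logm ge_max; apply/andP; split.
    by have := @ln_sublinear R (k%:R / 2) k20; lra.
  rewrite ln_pow4; have : ln 2 * k%:R <= l; last lra.
  exact: ln_pow2_le_scale.
have P : powR (logm (4 ^ k)%:R) (2 * c) <= expR (2 * c) * expR (2 * c * ll).
  rewrite /powR gt_eqF // -expRD ler_expR -[X in _ <= X + _]mulr1 -mulrDr ler_wpM2l //.
  apply: le_trans (_ : ln (2 * l) <= _); first by rewrite ler_ln ?posrE ?mulr_gt0.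
  by rewrite lnM ?posrE // lerD2r; lra.
rewrite WE yE /eta_weak; set T := expR (- (3 / 2) * ln ll).
have TT : T <= tail_weight k by rewrite /T /tail_weight ler_expR; lra.
set p := powR _ _ in P *.
rewrite [leLHS](_ : _ = 2 * 16 * r.+1%:R ^+ 3 * C ^+ 2 * s * ((p * expR (- (2 * c) * ll)) * T)); last first.
  by field; rewrite gt_eqF.
rewrite [leRHS](_ : _ = 2 * 16 * r.+1%:R ^+ 3 * C ^+ 2 * s * (expR (2 * c) * tail_weight k)); last first.
  by rewrite /D; ring.
rewrite ler_wpM2l ?mulr_ge0 ?exprn_ge0 ?(ltW C0) //.
rewrite ler_pM ?mulr_ge0 ?powR_ge0 ?expR_ge0 //.
apply: le_trans (ler_wpM2r (expR_ge0 _) P) _.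
by rewrite -!expRD ler_expR; lra.
Qed.

Lemma measure_strong_le r : exists2 C : R, 0 < C & forall k, (0 < k)%N -> 22 <= ln (k%:R / 2) :> R ->
  (mu (exceptional r (scale r k) (eta_strong k)) <= (C * (k%:R^-1 * tail_weight k))%:E)%E.
Proof.
have [C C0 HC] := measure_scale_le r; exists C => // k k0 hk.
have L0 : 0 < logm (4 ^ k)%:R :> R by rewrite (lt_le_trans ltr01) ?logm_ge1.
have s0 : 0 <= (logm (4 ^ k)%:R)^-1 :> R by rewrite invr_ge0 ltW.
rewrite eta_strongE mulrC; apply: le_trans (HC k _ hk s0) _; rewrite lee_fin -mulrA.
rewrite ler_wpM2l ?(ltW C0) // ler_wpM2r ?expR_ge0 //.
by rewrite lef_pV2 ?posrE ?ltr0n // le_logm_pow4.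
Qed.

(** Integral comparison: [- 2 / sqrt (ln x)] is an antiderivative of [1 / (x (ln x)^(3/2))]. *)
Lemma tail_weight_telescope k : 1 <= ln (k%:R / 2) :> R ->
  k.+1%:R^-1 * tail_weight k.+1 <=
  2 * ((Num.sqrt (ln (k%:R / 2)))^-1 - (Num.sqrt (ln (k.+1%:R / 2)))^-1).
Proof.
move=> hk; set a := ln _ in hk *.
have k0 : 0 < k%:R :> R.
  rewrite ltr0n lt0n; apply/eqP => E; move: hk; rewrite /a E mul0r ln0 //; lra.
have k20 : 0 < k%:R / 2 :> R by lra.
rewrite /tail_weight; set e := ln (k.+1%:R / 2).
have ae : a <= e by rewrite ler_ln ?posrE // -?(natr1 k); lra.
have gap : k.+1%:R^-1 <= e - a.
  rewrite /e /a -ln_div ?posrE ?divr_gt0 //.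
  have -> : k.+1%:R / 2 / (k%:R / 2) = (1 - k.+1%:R^-1)^-1 :> R.
    have S : k.+1%:R = k%:R + 1 :> R by rewrite natr1.
    by rewrite S; field; rewrite !gt_eqF //; lra.
  have i1 : k.+1%:R^-1 < 1 :> R by rewrite invf_lt1 ?ltr0n // ltr1n ltnS -(ltr0n R).
  rewrite lnV ?posrE ?subr_gt0 //.
  by have := @le_ln1Dx R (- k.+1%:R^-1); rewrite ltrN2 => /(_ i1); rewrite lerNr.
set s := Num.sqrt a; set t := Num.sqrt e.
have a0 : 0 < a by lra.
have e0 : 0 < e by lra.
have s0 : 0 < s by rewrite sqrtr_gt0.
have t0 : 0 < t by rewrite sqrtr_gt0.
have st : s <= t by rewrite ler_wsqrtr.
have aE : a = s ^+ 2 by rewrite sqr_sqrtr // ltW.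
have eE : e = t ^+ 2 by rewrite sqr_sqrtr // ltW.
have -> : expR (- (3 / 2) * ln e) = (t ^+ 3)^-1.
  rewrite eE lnXn // -{2}(lnK (x := t)) ?posrE // -expRM_natl -expRN; congr expR.
  by rewrite -mulr_natr; lra.
have -> : s^-1 - t^-1 = (e - a) / ((t + s) * (s * t)).
  by rewrite aE eE; field; rewrite !gt_eqF //; lra.
rewrite -invfM.
apply: le_trans (_ : (e - a) / t ^+ 3 <= _).
  by rewrite invfM ler_wpM2r // invr_ge0 exprn_ge0 // ltW.
rewrite mulrCA ler_wpM2l ?subr_ge0 //.
rewrite -[leLHS]div1r ler_pdivrMr ?exprn_gt0 // mulrAC ler_pdivlMr ?mulr_gt0 //; last lra.
rewrite mul1r !exprS expr0 mulr1.
have : (t + s) * (s * t) <= (t + t) * (t * t).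
  apply: ler_pM; [lra|by rewrite mulr_ge0 ?ltW|lra|by rewrite ler_wpM2r // ltW].
lra.
Qed.

Lemma sum_tail_weight K n : 1 <= ln (K%:R / 2) :> R ->
  \sum_(i < n) (K + i).+1%:R^-1 * tail_weight (K + i).+1 <= 2 * (Num.sqrt (ln (K%:R / 2)))^-1.
Proof.
move=> hK; have mono i : 1 <= ln ((K + i)%:R / 2) :> R.
  have K0 : 0 < K%:R / 2 :> R.
    by rewrite ltNge; apply/negP => /ln0 E; move: hK; rewrite E; lra.
  have KK : K%:R <= (K + i)%:R :> R by rewrite ler_nat leq_addr.
  apply: le_trans hK _; rewrite ler_ln ?posrE; lra.
suff : \sum_(i < n) (K + i).+1%:R^-1 * tail_weight (K + i).+1 <=
    2 * ((Num.sqrt (ln (K%:R / 2)))^-1 - (Num.sqrt (ln ((K + n)%:R / 2)))^-1) :> R.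
  move=> /le_trans; apply; rewrite ler_pM2l // gerBl invr_ge0 sqrtr_ge0 //.
elim: n => [|n IH]; first by rewrite big_ord0 addn0 subrr mulr0.
rewrite big_ord_recr /= addnS; apply: le_trans (lerD IH (tail_weight_telescope (mono n))) _.
lra.
Qed.

Lemma exists_ln_ge (M : R) : exists k : nat, M <= ln (k%:R / 2).
Proof.
exists (Num.truncn (2 * expR M)).+1.
have h : 2 * expR M < (Num.truncn (2 * expR M)).+1%:R by exact: truncnS_gt.
have e0 := expR_gt0 M.
rewrite -[leLHS]expRK ler_ln ?posrE ?expR_gt0 ?divr_gt0 // ler_pdivlMr // mulrC ltW //.
Qed.

Lemma le_ln_half (M : R) (k k' : nat) : 0 < M -> M <= ln (k%:R / 2) -> (k <= k')%N ->
  M <= ln (k'%:R / 2).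
Proof.
move=> M0 hk kk'; have k0 : 0 < k%:R / 2 :> R.
  by rewrite ltNge; apply/negP => /ln0 E; move: hk; rewrite E; lra.
have : k%:R <= k'%:R :> R by rewrite ler_nat.
move=> le; apply: le_trans hk _; rewrite ler_ln ?posrE; lra.
Qed.

Lemma negligible_strong r : mu.-negligible
  (lim_sup_set (fun k => exceptional r (scale r k) (eta_strong k))).
Proof.
have [C C0 HC] := measure_strong_le r.
have [K hK] := exists_ln_ge 22.
have hK1 : 1 <= ln (K%:R / 2) :> R by lra.
apply: (@negligibleS _ _ _ (@lebesgue_measure R) (lim_sup_set (fun j =>
    exceptional r (scale r (K + j).+1) (eta_strong (K + j).+1)))).
  move=> x hx n _; have [k /= nk Fk] := hx (K + n).+1 I.
  exists (k - K.+1)%N => /=; first by lia.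
  by have -> : (K + (k - K.+1)).+1 = k by lia.
apply: (@negligible_lim_sup _ _ (fun j => C * ((K + j).+1%:R^-1 * tail_weight (K + j).+1))
    (C * (2 * (Num.sqrt (ln (K%:R / 2)))^-1))).
- by move=> n; exact: measurable_exceptional.
- by move=> n; apply: HC => //; apply: le_ln_half hK _ => //; lia.
- by move=> n; rewrite -mulr_sumr ler_wpM2l ?(ltW C0) // sum_tail_weight.
Qed.

Lemma negligible_weak r m : mu.-negligible
  (\bigcap_(k in [set k | (m <= k)%N]) exceptional r (scale r k) (eta_weak k)).
Proof.
have [C C0 HC] := measure_scale_le r.
have [K hK] := exists_ln_ge 22.
apply: (@negligibleS _ _ _ (@lebesgue_measure R) (\bigcap_n exceptional r (scale r (m + K + n)%N) (eta_weak (m + K + n)%N))).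
  by move=> x hx n _; apply: hx => /=; lia.
apply: (@negligible_bigcap _ _ (fun n => C * tail_weight (m + K + n))).
- by move=> n; exact: measurable_exceptional.
- move=> n; have := HC (m + K + n)%N 1; rewrite mul1r mulr1; apply => //.
  by apply: le_ln_half hK _ => //; lia.
move=> e e0.
(* Ensures [ln (ln (k / 2)) >= |ln (e / C)|], hence [tail_weight k <= e / C], for the scale [k]
   reached. *)
have [n0 hn0] := exists_ln_ge (expR `|ln (e / C)|).
exists n0; rewrite -ler_pdivlMl // mulrC.
have eC : 0 < e / C by rewrite divr_gt0.
rewrite -[leRHS]lnK ?posrE // /tail_weight ler_expR.
have h1 : expR `|ln (e / C)| <= ln ((m + K + n0)%:R / 2).
  by apply: le_ln_half hn0 _; [exact: expR_gt0|lia].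
have : `|ln (e / C)| <= ln (ln ((m + K + n0)%:R / 2)).
  rewrite -[leLHS]expRK ler_ln ?posrE ?expR_gt0 //.
  exact: lt_le_trans (expR_gt0 _) h1.
have := ler_norm (- ln (e / C)); rewrite normrN.
have := normr_ge0 (ln (e / C)); lra.
Qed.

End Scales.

(** * Conclusion for almost every [alpha] *)

Theorem theorem6 (R : realType) :
  {ae (@lebesgue_measure R), forall alpha : R,
    0 < alpha -> ~ (exists q : rat, alpha = ratr q) ->
    (exists lam : nat -> R, sorted_enum alpha lam) /\
    (forall lam : nat -> R, sorted_enum alpha lam ->
       (exists N0 : nat, forall N : nat, (N0 <= N)%N -> (1 <= N)%N ->
          powR (logm N%:R) (2 * (@c_const R))%R / (N%:R * logm N%:R)%R < delta_min lam N) /\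
       (forall N0 : nat, exists N : nat, (N0 <= N)%N /\ (1 <= N)%N /\
          powR (logm N%:R) (2 * (@c_const R))%R / N%:R <= delta_min lam N))}.
Proof.
(* [S r] collects the [alpha] exceptional for [eta_strong] at infinitely many scales, [W r] those
   exceptional for [eta_weak] at all large scales; countably many [r] handle every [alpha > 0]. *)
pose S r := lim_sup_set (fun k => exceptional r (scale r k) (@eta_strong R k)).
pose W r := \bigcup_m \bigcap_(k in [set k | (m <= k)%N]) exceptional r (scale r k) (@eta_weak R k).
apply: (@negligibleS _ _ _ (@lebesgue_measure R) (\bigcup_r (S r `|` W r))); last first.
  apply: negligible_bigcup => r; apply: negligibleU; first exact: negligible_strong.
  by apply: negligible_bigcup => m; exact: negligible_weak.
rewrite -[X in _ `<=` X]setCK; apply: subsetC => alpha good a0 irr.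
split; first exact: sorted_enum_exists.
move=> lam se.
pose r := (Num.truncn (alpha + alpha^-1)).+1.
have ai0 : 0 < alpha^-1 by rewrite invr_gt0.
have rlt : alpha + alpha^-1 < r%:R by exact: truncnS_gt.
have r0 : (0 < r)%N by [].
have ra : r%:R^-1 <= alpha <= r%:R.
  by apply/andP; split; [rewrite invf_ple ?posrE ?ltr0n //|]; lra.
have scale_sq k : (4 ^ k.+1)%N = ((2 ^ k.+1) ^ 2)%N by rewrite -expnM mulnC expnM.
split.
  have [m hm] : exists m, forall k, (m <= k)%N -> ~ exceptional r (scale r k) (eta_strong k) alpha.
    apply: contrapT => h; apply: good; exists r => //; left => m _.
    apply: contrapT => h'; apply: h; exists m => k mk ex; apply: h'; exists k => //.
  exists (4 ^ (m + r))%N => N N0 N1.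
  pose k := trunc_log 4 N.
  have kN : (4 ^ k <= N)%N by exact: trunc_logP.
  have Nk : (N < 4 ^ k.+1)%N by exact: trunc_log_ltn.
  have mk : (m + r <= k)%N by exact: trunc_log_max.
  apply: le_lt_trans (target_le_eta_strong kN) _.
  apply: (delta_min_gt r0 ra irr se (z := (2 ^ k.+1)%N)).
  - by rewrite N1 -scale_sq.
  - by apply: le_lt_trans (eta_strong_le_weak _) _; apply: eta_weak_lt; lia.
  - by apply: hm; lia.
move=> N0.
have [k [Nk hk]] : exists k, (N0 + r <= k)%N /\ ~ exceptional r (scale r k) (eta_weak k) alpha.
  apply: contrapT => h; apply: good; exists r => //; right; exists (N0 + r)%N => // k /= mk.
  by apply: contrapT => h'; apply: h; exists k.
have k4 : (k < 4 ^ k)%N by exact: ltn_expl.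
(* At [N = 4^k] the weak threshold is the target itself, and [N < 4^(k+1) = z^2]. *)
exists (4 ^ k)%N; split; first by lia.
split; first by rewrite expn_gt0.
apply: ltW; apply: (delta_min_gt r0 ra irr se (z := (2 ^ k.+1)%N)).
- by rewrite expn_gt0 /= -scale_sq ltn_exp2l.
- by apply: eta_weak_lt; lia.
- exact: hk.
Qed.
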